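(* The Hamiltonian path problem restricted to monotone convex bipartite graphs is solvable in linear time: there is an algorithm which, given a monotone convex bipartite graph $G$ together with its convex ordering of $X$, decides whether $G$ has a Hamiltonian path and, if so, outputs one, in time linear in the size of $G$.
   Context: All graphs are finite, simple, connected and unweighted. A convex bipartite graph is a bipartite graph $G$ with bipartition $(X,Y)$ together with an ordering $X=(x_1,\ldots,x_n)$ such that for every $y\in Y$ the neighborhood $N_G(y)$ consists of consecutive vertices of this ordering; $n=|X|$. For $1\le p<q\le n$ let $X_{p..q}=\{x_p,\ldots,x_q\}$, $N_G[X_{p..q}]=\{y\in Y : N_G(y)\subseteq X_{p..q}\}$ and $N'_G[X_{p..q}]=\{y\in Y : |N_G(y)\cap X_{p..q}|\ge 2\}$. A vertex is pendant if it has degree $1$. $G$ satisfies Property B if: (1) (upper bound) for all $1\le p<q\le n$ with $(p,q)\ne(1,n)$, $|N_G[X_{p..q}]|\le q-p+1$, and $|N_G[X_{1..n}]|\le n+1$; (2) (lower bound) for every integer $j\in\{1,\ldots,n-1\}$ and all indices with $1\le p_1<q_1\le p_2<q_2\le\cdots\le p_j<q_j\le n$, $\left|\bigcup_{i=1}^j N'_G[X_{p_i..q_i}]\right|\ge\sum_{i=1}^j (q_i-p_i)$; (3) (pendant bound) $G$ has at most $2$ pendant vertices, and if $n\ge 2$ no $x\in X$ is adjacent to two pendant vertices of $Y$. A set $X_{p..q}$ ($1\le p<q\le n$) is maximal if $|N_G[X_{p..q}]|=q-p+1$ and there is no $X_{p'..q'}$ with $|N_G[X_{p'..q'}]|=q'-p'+1$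 and either $1<p'<p<q\le q'<n$ or $1<p'\le p<q<q'<n$. $G$ is monotone if it satisfies Property B, no pendant vertex $y\in Y$ is adjacent to some $x_k$ with $1<k<n$, and there is no maximal set $X_{p..q}$ with $1<p<q<n$. *)

(* Defs.v *)
From mathcomp Require Import all_boot.

Set Implicit Arguments.
Unset Strict Implicit.
Unset Printing Implicit Defensive.

(* A graph is a relation [e] on a finite type of vertices.  The sequence [xs]
   is the ordering (x_1, ..., x_n) of the side X, the side Y being the
   complement of [xs].  Positions p, q in the ordering are natural numbers
   counted from 1. *)
Section ConvexBipartite.

Variables (V : finType) (e : rel V) (xs : seq V).

Definition nbr (v : V) : {set V} := [set u | e v u].

(* Halving is exact for a symmetric irreflexive [e]. *)
Definition num_edges : nat := #|[set a : V * V | e a.1 a.2]|./2.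

Definition gsize : nat := #|V| + num_edges.

Definition simple_graph : Prop := symmetric e /\ irreflexive e.

Definition connected_graph : Prop :=
  0 < #|V| /\ forall u v : V, connect e u v.

Definition bipartition : Prop :=
  forall u v : V, e u v -> (u \in xs) != (v \in xs).

Definition Xint (p q : nat) : {set V} :=
  [set x in xs | p <= (index x xs).+1 <= q].

Definition Yside : {set V} := [set y | y \notin xs].

(* An isolated y has the empty interval (p > q) as its neighbourhood. *)
Definition convex_ordering : Prop :=
  forall y, y \in Yside -> exists p q : nat, nbr y = Xint p q.

Definition convex_bipartite : Prop :=
  [/\ simple_graph, connected_graph, uniq xs, bipartition & convex_ordering].

Definition Ninside (p q : nat) : {set V} :=
  [set y in Yside | nbr y \subset Xint p q].

Definition Ntwice (p q : nat) : {set V} :=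
  [set y in Yside | 2 <= #|nbr y :&: Xint p q|].

Definition pendant (v : V) : bool := #|nbr v| == 1.

Definition upper_bound : Prop :=
  (forall p q, 1 <= p -> p < q -> q <= size xs -> (p, q) <> (1, size xs) ->
     #|Ninside p q| <= q - p + 1)
  /\ #|Ninside 1 (size xs)| <= size xs + 1.

Definition lower_bound : Prop :=
  forall (j : nat) (p q : nat -> nat),
    1 <= j <= size xs - 1 ->
    1 <= p 1 ->
    (forall i, 1 <= i <= j -> p i < q i) ->
    (forall i, 1 <= i < j -> q i <= p i.+1) ->
    q j <= size xs ->
    \sum_(1 <= i < j.+1) (q i - p i)
      <= #|\bigcup_(1 <= i < j.+1) Ntwice (p i) (q i)|.

Definition pendant_bound : Prop :=
  #|[set v | pendant v]| <= 2 /\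
  (2 <= size xs ->
   forall x y y', x \in xs -> y \in Yside -> y' \in Yside ->
     pendant y -> pendant y' -> e x y -> e x y' -> y = y').

Definition property_B : Prop := [/\ upper_bound, lower_bound & pendant_bound].

Definition tight (p q : nat) : Prop :=
  [/\ 1 <= p, p < q, q <= size xs & #|Ninside p q| = q - p + 1].

Definition maximal_set (p q : nat) : Prop :=
  tight p q /\
  ~ (exists p' q', tight p' q' /\
      ([/\ 1 < p', p' < p, p < q, q <= q' & q' < size xs] \/
       [/\ 1 < p', p' <= p, p < q, q < q' & q' < size xs])).

Definition monotone_graph : Prop :=
  [/\ property_B,
      (forall x y, y \in Yside -> pendant y -> x \in xs -> e y x ->
         ~ (1 < (index x xs).+1 < size xs))
    & ~ (exists p q, [/\ maximal_set p q, 1 < p, p < q & q < size xs])].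

Definition hamiltonian_path (s : seq V) : Prop :=
  [/\ sorted e s, uniq s & forall v, v \in s].

End ConvexBipartite.

(* A structured word RAM.  A machine has word-valued variables and
   word-indexed arrays of words (a program mentions only finitely many of
   each).  In the semantics [w] is the number of distinct machine words: an
   operation whose result is not < w has no value and the program is stuck.
   Each node of an expression and each command executed costs one time unit. *)

Inductive binop := OAdd | OSub | OMul | ODiv | OMod | OEq | OLt.

Definition eval_binop (o : binop) (a b : nat) : nat :=
  match o with
  | OAdd => a + b
  | OSub => a - b
  | OMul => a * b
  | ODiv => a %/ b
  | OMod => a %% b
  | OEq => a == b
  | OLt => a < b
  end.

Inductive exp :=
  | Const of nat
  | Var of nat
  | Get of nat & exp
  | Bin of binop & exp & exp.

Inductive cmd :=
  | Skip
  | Set_var of nat & exp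
  | Set_arr of nat & exp & exp
  | Seq of cmd & cmd
  | If of exp & cmd & cmd
  | While of exp & cmd.

Record state := State { vars : nat -> nat; arrs : nat -> nat -> nat }.

Definition upd (A : Type) (f : nat -> A) (i : nat) (a : A) : nat -> A :=
  fun j => if j == i then a else f j.

Definition put_var (st : state) (x v : nat) : state :=
  State (upd (vars st) x v) (arrs st).

Definition put_arr (st : state) (a i v : nat) : state :=
  State (vars st) (upd (arrs st) a (upd (arrs st a) i v)).

Definition word (w v : nat) : option nat := if v < w then Some v else None.

Fixpoint eval (w : nat) (st : state) (ex : exp) : option nat :=
  match ex with
  | Const v => word w v
  | Var x => word w (vars st x)
  | Get a i => obind (fun vi => word w (arrs st a vi)) (eval w st i)
  | Bin o e1 e2 =>
      obind (fun v1 => obind (fun v2 => word w (eval_binop o v1 v2))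
                             (eval w st e2))
            (eval w st e1)
  end.

Fixpoint exp_cost (ex : exp) : nat :=
  match ex with
  | Const _ | Var _ => 1
  | Get _ i => (exp_cost i).+1
  | Bin _ e1 e2 => (exp_cost e1 + exp_cost e2).+1
  end.

(* [exec w c st t st'] : started in [st], [c] halts in [st'] after [t] units. *)
Inductive exec (w : nat) : cmd -> state -> nat -> state -> Prop :=
  | exec_skip st : exec w Skip st 1 st
  | exec_set_var st x ex v :
      eval w st ex = Some v ->
      exec w (Set_var x ex) st (exp_cost ex).+1 (put_var st x v)
  | exec_set_arr st a e1 e2 i v :
      eval w st e1 = Some i -> eval w st e2 = Some v ->
      exec w (Set_arr a e1 e2) st (exp_cost e1 + exp_cost e2).+1
             (put_arr st a i v)
  | exec_seq st st1 st2 c1 c2 t1 t2 :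
      exec w c1 st t1 st1 -> exec w c2 st1 t2 st2 ->
      exec w (Seq c1 c2) st (t1 + t2).+1 st2
  | exec_if_true st st1 ex c1 c2 v t :
      eval w st ex = Some v -> v != 0 -> exec w c1 st t st1 ->
      exec w (If ex c1 c2) st (exp_cost ex + t).+1 st1
  | exec_if_false st st1 ex c1 c2 t :
      eval w st ex = Some 0 -> exec w c2 st t st1 ->
      exec w (If ex c1 c2) st (exp_cost ex + t).+1 st1
  | exec_while_true st st1 st2 ex c v t1 t2 :
      eval w st ex = Some v -> v != 0 ->
      exec w c st t1 st1 -> exec w (While ex c) st1 t2 st2 ->
      exec w (While ex c) st (exp_cost ex + t1 + t2).+1 st2
  | exec_while_false st ex c :
      eval w st ex = Some 0 ->
      exec w (While ex c) st (exp_cost ex).+1 st.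

(* Array 0 holds the input; everything else is initially 0. *)
Definition init_state (input : seq nat) : state :=
  State (fun _ => 0) (fun a i => if a == 0 then nth 0 input i else 0).

Definition adjacency_lists (N : nat) (e : rel 'I_N)
    (adj : 'I_N -> seq 'I_N) : Prop :=
  forall v, uniq (adj v) /\ forall u, (u \in adj v) = e v u.

(* The number of vertices, the number n of vertices in X, the names of
   x_1, ..., x_n in this order, and then, for each vertex name 0, ..., N-1, its
   degree followed by the names of its neighbours. *)
Definition encode (N : nat) (xs : seq 'I_N) (adj : 'I_N -> seq 'I_N)
    : seq nat :=
  [:: N, size xs & map val xs] ++
  flatten [seq size (adj v) :: map val (adj v) | v <- enum 'I_N].

(* Array 1 holds the output: a Boolean answer, followed by the names of the
   vertices along a Hamiltonian path if the answer is positive. *)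
Definition correct_output (N : nat) (e : rel 'I_N) (st : state) : Prop :=
  (arrs st 1 0 = 1 /\
   exists s : seq 'I_N, hamiltonian_path e s /\
     [seq arrs st 1 i.+1 | i <- iota 0 N] = map val s)
  \/ (arrs st 1 0 = 0 /\ ~ exists s : seq 'I_N, hamiltonian_path e s).

(* Main.v *)
(* Let n = |X|, let x_1, ..., x_n be the ordering and give the path the slots
   0, ..., n: slot i with 0 < i < n lies between x_i and x_(i+1), slots 0 and n
   are the two ends.  A Hamiltonian path x_1, ..., x_n in this order amounts to
   a matching of Y with |Y| consecutive slots, where y may fill an interval of
   slots.  The lower bound gives |Y| >= n - 1 and the upper bound |Y| <= n + 1;
   monotonicity says that at most q - p vertices of Y have all their neighbours
   in X_{p..q} when 1 < p <= q < n, so Hall's condition can fail only at a tight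
   prefix or a tight suffix of X.  Neither exists for the slots 1, ..., n - 1 if
   |Y| = n - 1, both are harmless for the slots 0, ..., n if |Y| = n + 1, and if
   |Y| = n they cannot occur together, so that the slots 1, ..., n or the slots
   0, ..., n - 1 can be matched.  Hence there always is a Hamiltonian path.  The
   program finds one by filling the slots in increasing order with the fitting y
   of earliest deadline, for which slot i scans only the neighbours of x_i; when
   |Y| = n it tries the slots 1, ..., n first. *)
Require Import Defs.
From mathcomp Require Import all_boot zify.

Set Implicit Arguments.
Unset Strict Implicit.
Unset Printing Implicit Defensive.

(** * Hall's condition and the earliest-deadline rule *)

Section EarliestDeadline.

Variables (T : finType) (Y : {set T}) (a d : T -> nat) (s0 s1 : nat).

(* Job y may run in the slots a y, ..., d y - 1, and the available slots are
   s0, ..., s1 - 1: a release time is void at u = s0, a deadline at v = s1. *)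
Definition hall : Prop :=
  forall u v, s0 <= u -> u <= v -> v <= s1 ->
    #|[set y in Y | ((u == s0) || (u <= a y)) && ((v == s1) || (d y <= v))]|
      <= v - u.

Definition idle (pk : nat -> T) (s : nat) (y : T) : Prop :=
  y \in Y /\ forall j, s0 <= j < s -> pk j <> y.

Definition earliest_deadline (pk : nat -> T) (s : nat) : Prop :=
  forall i, s0 <= i < s ->
    [/\ idle pk i (pk i), a (pk i) <= i < d (pk i)
      & forall y, idle pk i y -> a y <= i < d y -> d (pk i) <= d y].

Lemma earliest_deadline_inj pk s i j : earliest_deadline pk s ->
  s0 <= i < s -> s0 <= j < s -> pk i = pk j -> i = j.
Proof.
move=> ED; wlog lt_ij: i j / i < j => [WL hi hj E|hi hj E].
  case: (ltngtP i j) => // h; first exact: WL.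
  by apply/esym/WL.
have [[_ N] _ _] := ED j hj.
by case: (N i); first lia.
Qed.

(* If no job fits slot s, then either an idle job has missed its deadline v,
   and Hall's condition fails on the longest run of slots up to v that were
   given to jobs with deadline at most v, or all idle jobs are released after
   s, and there are too many of them for the remaining slots. *)
Lemma earliest_deadline_step pk s :
  hall -> #|Y| = s1 - s0 -> (forall y, y \in Y -> s0 <= d y) ->
  s0 <= s < s1 -> earliest_deadline pk s ->
  exists y, idle pk s y /\ a y <= s < d y.
Proof.
move=> H cY d_ge hs ED.
pose P := [seq pk i | i <- index_iota s0 s].
have idleE y : y \in Y -> y \notin P -> idle pk s y.
  move=> yY yP; split=> // j hj E; move/negP: yP; apply; rewrite -E.
  by apply: map_f; rewrite mem_index_iota.
have szP : size P = s - s0 by rewrite size_map size_iota.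
case: (boolP [exists y, [&& y \in Y, y \notin P & a y <= s < d y]]).
  by case/existsP=> y /and3P[yY yP h]; exists y; split=> //; exact: idleE.
rewrite negb_exists => /forallP none; exfalso.
have {}none y : y \in Y -> y \notin P -> d y <= s \/ s < a y.
  by move=> yY yP; move: (none y); rewrite yY yP /=; lia.
case: (boolP [exists z, [&& z \in Y, z \notin P & d z <= s]]).
  case/existsP=> z /and3P[zY zP dz].
  have [_ zI] := idleE z zY zP.
  pose v := d z; have v_ge : s0 <= v by exact: d_ge.
  (* [Q u] says that all slots from [u] up to [v] went to jobs with deadline at most [v]; the least
     such [u] starts the longest run. *)
  pose Q u := (s0 <= u <= v) && all (fun i => d (pk i) <= v) (index_iota u v).
  have exQ : exists u, Q u.
    by exists v; rewrite /Q v_ge leqnn /index_iota subnn.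
  case: (ex_minnP exQ) => u /andP[hu /allP allQ] minQ.
  have run i : u <= i < v -> d (pk i) <= v.
    by move=> hi; apply: allQ; rewrite mem_index_iota.
  (* An idle job released before [u] with deadline in [[u, v]] could have run in slot [u.-1]; so
     that slot also went to a deadline at most [v], against the minimality of [u]. *)
  have early y : idle pk u.-1 y -> u <= d y <= v -> (u == s0) || (u <= a y).
    move=> yI dy; case: (eqVneq u s0) => //= nu.
    have hu1 : s0 <= u.-1 < s by lia.
    rewrite leqNgt; apply/negP => lt_au.
    have : Q u.-1.
      rewrite /Q; apply/andP; split; first lia.
      apply/allP=> i; rewrite mem_index_iota => hi.
      case: (leqP u i) => h; first by apply: run; lia.
      have -> : i = u.-1 by lia.
      have [_ _ best] := ED _ hu1.
      have h1 : a y <= u.-1 < d y by lia.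
      by have := best y yI h1; lia.
    by move/minQ; lia.
  pose S := z :: [seq pk i | i <- index_iota u v].
  have uS : uniq S.
    rewrite /= map_inj_in_uniq ?iota_uniq ?andbT.
      apply/mapP=> -[i]; rewrite mem_index_iota => hi E.
      by apply: (zI i) => //; lia.
    move=> i j; rewrite !mem_index_iota => hi hj E.
    by apply: (earliest_deadline_inj ED _ _ E); lia.
  have sub : {subset S <= [set y in Y | ((u == s0) || (u <= a y))
                                      && ((v == s1) || (d y <= v))]}.
    move=> y; rewrite inE inE => /orP[/eqP-> | /mapP[i]].
      rewrite zY /v leqnn orbT andbT; apply: early; last lia.
      by split=> // j hj; apply: zI; lia.
    rewrite mem_index_iota => hi ->.
    have hi' : s0 <= i < s by lia.
    have [[pY pN] hai _] := ED i hi'; have dv := run i hi.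
    rewrite pY dv orbT andbT; apply: early; last lia.
    by split=> // j hj; apply: pN; lia.
  have := uniq_leq_size uS (s2 := enum _)
            (fun y h => etrans (mem_enum _ y) (sub y h)).
  rewrite -cardE /= size_map size_iota.
  by have := H u v; lia.
rewrite negb_exists => /forallP late.
(* At least [s1 - s] jobs are unscheduled and all are released after [s], but the window from [s.+1]
   to [s1] has only [s1 - s - 1] slots. *)
have /subset_leq_card : Y :\: [set y in P] \subset
    [set y in Y | ((s.+1 == s0) || (s.+1 <= a y))
                  && ((s1 == s1) || (d y <= s1))].
  apply/subsetP=> y; rewrite !inE eqxx => /andP[yP yY].
  by move: (late y) (none y yY yP); rewrite yY yP /= -ltnNge => h1 [h2|h2]; lia.
have cP : #|[set y in P]| <= s - s0 by rewrite cardsE -szP card_size.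
have := cardsD Y [set y in P].
have := subset_leq_card (subsetIr Y [set y in P]).
have := H s.+1 s1; lia.
Qed.

Lemma earliest_deadline_extend pk s y :
  earliest_deadline pk s -> idle pk s y -> a y <= s < d y ->
  (forall z, idle pk s z -> a z <= s < d z -> d y <= d z) ->
  earliest_deadline (upd pk s y) s.+1.
Proof.
move=> ED yI hy best.
have updE i : i < s -> upd pk s y i = pk i.
  by rewrite /upd; case: eqP => // ->; rewrite ltnn.
have idleE i z : i <= s -> idle (upd pk s y) i z <-> idle pk i z.
  move=> hi; split=> -[zY zI]; split=> // j hj.
    by rewrite -updE; [apply: zI | lia].
  by rewrite updE; [apply: zI | lia].
move=> i hi; case: (ltnP i s) => h.
  have hi' : s0 <= i < s by lia.
  have [pI ha pd] := ED i hi'; rewrite updE //; split=> //.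
    by apply/idleE => //; lia.
  by move=> z /idleE zI; apply: pd; apply: zI; lia.
have -> : i = s by lia.
have -> : upd pk s y s = y by rewrite /upd eqxx.
split=> //; first by apply/idleE.
by move=> z /idleE zI; apply: best; apply: zI.
Qed.

End EarliestDeadline.

(** * Matching Y with slots in a monotone graph *)

Section Monotone.

Variables (V : finType) (e : rel V) (xs : seq V).

Definition first_nbr (y : V) : nat := (find (e y) xs).+1.
Definition last_nbr (y : V) : nat := \max_(x in nbr e y) (index x xs).+1.

(* Slot i in 1, ..., n - 1 of a Hamiltonian path lies between x_i and x_(i+1),
   slot 0 precedes x_1 and slot n follows x_n. *)
Definition release (y : V) : nat :=
  if first_nbr y == 1 then 0 else first_nbr y.
(** Deadlines are exclusive, so a neighbour of [x_n], which may also fill the end slot [n], gets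
    [n + 1]. *)
Definition deadline (y : V) : nat :=
  if last_nbr y == size xs then (size xs).+1 else last_nbr y.

Hypotheses (CB : convex_bipartite e xs) (n_gt0 : 0 < size xs).

Local Notation n := (size xs).

Lemma Yside_nbr_mem y x : y \in Yside xs -> e y x -> x \in xs.
Proof.
case: CB => _ _ _ bip _; rewrite inE => /negPf yY /bip.
by rewrite yY; case: (x \in xs).
Qed.

Lemma Yside_has_nbr y : y \in Yside xs -> exists x, e y x.
Proof.
case: CB => _ [_ con] _ _ _ yY.
case: xs yY n_gt0 => // x0 s; rewrite !inE negb_or => /andP[ny _] _.
case/connectP: (con y x0) => -[|z p] /=; last by case/andP=> h _ _; exists z.
by move=> _ E; rewrite E eqxx in ny.
Qed.

Lemma has_nbr y : y \in Yside xs -> has (e y) xs.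
Proof.
move=> yY; have [x h] := Yside_has_nbr yY.
by apply/hasP; exists x => //; apply: Yside_nbr_mem h.
Qed.

Lemma first_nbr_bounds y : y \in Yside xs -> 0 < first_nbr y <= last_nbr y.
Proof.
move=> yY; have h := has_nbr yY; case: CB => _ _ Uxs _ _.
have [x0 _] := Yside_has_nbr yY; have ex := nth_find x0 h.
rewrite /last_nbr (bigD1 (nth x0 xs (find (e y) xs))) ?inE //=.
by rewrite index_uniq -?has_find // leq_maxl.
Qed.

Lemma last_nbr_le y : y \in Yside xs -> last_nbr y <= n.
Proof.
move=> yY; apply/bigmax_leqP=> x; rewrite inE => /(Yside_nbr_mem yY).
by rewrite index_mem.
Qed.

Lemma last_nbrP y : y \in Yside xs ->
  exists x, [/\ e y x, x \in xs & last_nbr y = (index x xs).+1].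
Proof.
move=> yY; have [x h] := Yside_has_nbr yY.
have hx : x \in nbr e y by rewrite inE.
have nb : 0 < #|nbr e y| by apply/card_gt0P; exists x.
have [z] := eq_bigmax_cond (fun x => (index x xs).+1) nb.
rewrite inE => ez E; exists z; split=> //.
exact: Yside_nbr_mem ez.
Qed.

(** The interval [p, q] given by convexity may stick out of [1, ..., n]; its ends are therefore only
    compared with the extreme neighbours. *)
Lemma nbr_interval x0 y i : y \in Yside xs -> i < n ->
  e y (nth x0 xs i) = (first_nbr y <= i.+1 <= last_nbr y).
Proof.
move=> yY lt_i; case: (CB) => _ _ Uxs _ conv.
have [p [q E]] := conv y yY.
have eE x : x \in xs -> e y x = (p <= (index x xs).+1 <= q).
  by move=> hx; move/setP/(_ x): E; rewrite !inE hx.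
have h := has_nbr yY; have hf := nth_find x0 h.
have lt_f : find (e y) xs < n by rewrite -has_find.
have [z [ez zx Ez]] := last_nbrP yY.
apply/idP/idP=> [ex|].
  apply/andP; split; last first.
    rewrite /last_nbr (bigD1 (nth x0 xs i)) ?inE //=.
    by rewrite index_uniq // leq_maxl.
  by rewrite /first_nbr ltnS leqNgt; apply/negP => /(before_find x0); rewrite ex.
move: hf ez; rewrite !eE ?mem_nth // !index_uniq //.
by rewrite Ez /first_nbr; lia.
Qed.

Lemma Ninside_nbr p q y : 1 <= p ->
  (y \in Ninside e xs p q) =
  [&& y \in Yside xs, p <= first_nbr y & last_nbr y <= q].
Proof.
move=> p_gt0; rewrite in_set; case: (boolP (y \in Yside xs)) => //= yY.
case: (CB) => _ _ Uxs _ _.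
have h := has_nbr yY; have [x0 _] := Yside_has_nbr yY; have hf := nth_find x0 h.
have lt_f : find (e y) xs < n by rewrite -has_find.
have [z [ez zx Ez]] := last_nbrP yY.
apply/subsetP/idP=> [sub|/andP[hp hq] x].
  have := sub z; have := sub (nth x0 xs (find (e y) xs)).
  rewrite !inE mem_nth // index_uniq // zx /= -/(first_nbr y) -Ez => A B.
  have := A hf; have := B ez; lia.
rewrite !inE => ex; have xx := Yside_nbr_mem yY ex; rewrite xx /=.
rewrite -{}(nth_index x0 xx) in ex.
by move: ex; rewrite nbr_interval ?index_mem //; lia.
Qed.

Lemma Ntwice_nbr p q y : 1 <= p -> q <= n -> y \in Ntwice e xs p q ->
  [/\ y \in Yside xs, first_nbr y < q & p < last_nbr y].
Proof.
move=> p_gt0 q_le; rewrite in_set => /andP[yY].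
case/card_gt1P=> u [v []]; rewrite !inE => /andP[eu /andP[ux hu]].
move=> /andP[ev /andP[vx hv]] ne_uv.
have : index u xs != index v xs.
  by apply: contraNneq ne_uv => E; apply/eqP/(index_inj u ux vx E).
move: eu ev; rewrite -{1}(nth_index u ux) -{1}(nth_index u vx).
by rewrite !nbr_interval ?index_mem //; split; [rewrite inE in yY | lia | lia].
Qed.

(** * Counting bounds for intervals of X in a monotone graph *)

Hypothesis M : monotone_graph e xs.

(** The upper bound concerns only [p < q]; for a single [x_k] this lets the pendant conditions take
    over. *)
Lemma Ninside_pendant k y : y \in Ninside e xs k k -> 1 <= k <= n ->
  pendant e y /\ exists x, [/\ x \in xs, e y x & (index x xs).+1 = k].
Proof.
move=> yN hk; have k1 : 1 <= k by lia.
have [yY sub] : y \in Yside xs /\ nbr e y \subset Xint xs k k.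
  by move: yN; rewrite inE => /andP[].
have [x ex] := Yside_has_nbr yY.
have hx z : e y z -> z \in xs /\ (index z xs).+1 = k.
  move=> ez; have : z \in Xint xs k k by apply: (subsetP sub); rewrite inE.
  by rewrite inE => /andP[zx] h; split=> //; lia.
have [xx Ex] := hx x ex; split; last by exists x.
rewrite /pendant (_ : nbr e y = [set x]) ?cards1 //.
apply/setP=> z; rewrite !inE; apply/idP/eqP=> [ez|->//].
have [zx Ez] := hx z ez; apply: (index_inj z zx xx); lia.
Qed.

(** A tight inner interval that is not maximal lies in a longer tight inner one. Enlarging ends at
    an inner maximal set, which monotonicity forbids. *)
Lemma not_tight p q : 1 < p -> p < q -> q < n -> ~ tight e xs p q.
Proof.
case: M => _ _ nomax.
have [k] := ubnP (n - (q - p)); elim: k p q => // k IH p q hk p1 pq qn T.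
apply: nomax; exists p, q; split=> //; split=> // -[p' [q' [T' D]]].
by apply: (IH p' q' _ _ _ _ T'); case: D => -[] *; lia.
Qed.

Lemma card_Ninside_mid p q : 1 < p -> p <= q -> q < n ->
  #|Ninside e xs p q| <= q - p.
Proof.
case: (M) => -[[ub _] _ _] nopend _ p1 pq qn; case: (ltnP p q) => h.
  have ub' : #|Ninside e xs p q| <= q - p + 1.
    by apply: ub => //; [lia | lia | case; lia].
  suff : #|Ninside e xs p q| <> q - p + 1 by lia.
  by move=> E; apply: (@not_tight p q) => //; split=> //; lia.
have -> : q = p by lia.
rewrite subnn leqn0 cards_eq0; apply/set0Pn=> -[y yN].
have [|Py [x [xx ex Ex]]] := Ninside_pendant yN; first lia.
have yY : y \in Yside xs by move: yN; rewrite inE => /andP[].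
by apply: (nopend x y yY Py xx ex); lia.
Qed.

Lemma card_Ninside_one k : 1 <= k <= n -> 1 < n ->
  #|Ninside e xs k k| <= 1.
Proof.
move=> hk n1; case: (M) => -[_ _ [_ pb]] _ _.
case: (CB) => -[sym _] _ Uxs _ _.
rewrite leqNgt; apply/negP => /card_gt1P[y [y' [yN y'N /eqP ne]]].
have [Py [x [xx ex Ex]]] := Ninside_pendant yN hk.
have [Py' [x' [xx' ex' Ex']]] := Ninside_pendant y'N hk.
have E : x = x' by apply: (index_inj x xx xx'); lia.
move: yN y'N; rewrite !inE => /andP[yY _] /andP[y'Y _].
apply: ne; apply: (pb n1 x) => //; rewrite ?inE // sym //.
by rewrite E.
Qed.

Lemma card_Ninside_prefix q : q < n -> #|Ninside e xs 1 q| <= q.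
Proof.
case: (M) => -[[ub _] _ _] _ _ qn.
case: (ltngtP q 1) => [q0|q1|E]; last first.
- by rewrite E in qn *; apply: card_Ninside_one; lia.
- have := ub 1 q; rewrite subn1 addn1 prednK; last lia.
  by apply=> //; [lia | case; lia].
have -> : q = 0 by lia.
rewrite leqn0 cards_eq0; apply/set0Pn=> -[y]; rewrite Ninside_nbr //.
by case/and3P=> /first_nbr_bounds; lia.
Qed.

Lemma card_Ninside_suffix p : 1 < p -> #|Ninside e xs p n| <= n.+1 - p.
Proof.
case: (M) => -[[ub _] _ _] _ _ p1.
case: (ltngtP p n) => [pn|np|E].
- suff : #|Ninside e xs p n| <= n - p + 1 by lia.
  by apply: ub => //; [lia | case; lia].
- rewrite leqNgt; apply/negP => /(leq_ltn_trans (leq0n _)) /card_gt0P[y].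
  rewrite Ninside_nbr; last lia.
  by case/and3P=> yY; have := first_nbr_bounds yY; have := last_nbr_le yY; lia.
- by rewrite E subSnn; apply: card_Ninside_one; lia.
Qed.

Lemma card_Yside_le : #|Yside xs| <= n.+1.
Proof.
case: (M) => -[[_ ub] _ _] _ _; rewrite -addn1; apply: leq_trans ub.
apply/subset_leq_card/subsetP=> y yY; rewrite Ninside_nbr // yY /=.
by have := first_nbr_bounds yY; have := last_nbr_le yY; lia.
Qed.

Lemma card_Ntwice_ge p q : 1 <= p -> p < q -> q <= n ->
  q - p <= #|Ntwice e xs p q|.
Proof.
move=> p1 pq qn; case: (M) => -[_ lb _] _ _.
have := lb 1 (fun=> p) (fun=> q); rewrite !big_nat1.
by apply=> //; lia.
Qed.

(** The two intervals share at most one position, so a vertex confined to the first cannot have two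
    neighbours in the second. *)
Lemma Ninside_Ntwice_disjoint p q p' q' :
  1 <= p -> 1 <= p' -> q' <= n -> (q <= p') || (q' <= p) ->
  [disjoint Ninside e xs p q & Ntwice e xs p' q'].
Proof.
move=> p1 p'1 q'n h; rewrite -setI_eq0; apply/set0Pn=> -[y].
rewrite inE Ninside_nbr // => /andP[/and3P[_ h1 h2]].
by case/(Ntwice_nbr p'1 q'n) => _ h3 h4; move: h h1 h2 h3 h4; lia.
Qed.

Lemma Ninside_sub p q : Ninside e xs p q \subset Yside xs.
Proof. by apply/subsetP=> y; rewrite inE => /andP[]. Qed.

Lemma Ntwice_sub p q : Ntwice e xs p q \subset Yside xs.
Proof. by apply/subsetP=> y; rewrite inE => /andP[]. Qed.

Lemma card_Yside_ge : n.-1 <= #|Yside xs|.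
Proof.
case: (ltnP 1 n) => [n1|]; last lia.
have := subset_leq_card (Ntwice_sub 1 n).
by have := @card_Ntwice_ge 1 n isT n1 (leqnn _); lia.
Qed.

Lemma card_Ninside_few p q p' q' :
  1 <= p -> 1 <= p' -> p' < q' -> q' <= n -> (q <= p') || (q' <= p) ->
  #|Ninside e xs p q| + (q' - p') <= #|Yside xs|.
Proof.
move=> p1 p'1 pq' q'n h.
have D := Ninside_Ntwice_disjoint p1 p'1 q'n h.
have S : Ninside e xs p q :|: Ntwice e xs p' q' \subset Yside xs.
  by rewrite subUset Ninside_sub Ntwice_sub.
have := subset_leq_card S; rewrite cardsU disjoint_setI0 // cards0 subn0.
by have := card_Ntwice_ge p'1 pq' q'n; lia.
Qed.

(* Tight prefixes and tight suffixes exclude each other when |Y| = n: disjoint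
   ones leave too few y's for the gap in between, overlapping ones contain more
   than n y's. *)
Lemma tight_prefix_suffix p q : #|Yside xs| = n ->
  1 <= q < n -> 1 < p <= n -> q <= #|Ninside e xs 1 q| ->
  #|Ninside e xs p n| <= n - p.
Proof.
move=> cY hq hp tq; rewrite leqNgt; apply/negP => tp.
have U : Ninside e xs 1 q :|: Ninside e xs p n \subset Yside xs.
  by rewrite subUset !Ninside_sub.
case: (ltnP q p) => qp.
  have D : [disjoint Ninside e xs 1 q :|: Ninside e xs p n & Ntwice e xs q p].
    rewrite -setI_eq0 setIUl setU_eq0 !setI_eq0.
    by apply/andP; split; apply: Ninside_Ntwice_disjoint; lia.
  have D' : [disjoint Ninside e xs 1 q & Ninside e xs p n].
    rewrite -setI_eq0; apply/set0Pn=> -[y].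
    rewrite inE !Ninside_nbr //; last lia.
    by case/andP=> /and3P[/first_nbr_bounds]; lia.
  have S : (Ninside e xs 1 q :|: Ninside e xs p n) :|: Ntwice e xs q p
             \subset Yside xs.
    by rewrite subUset U Ntwice_sub.
  have := subset_leq_card S; rewrite !cardsU !disjoint_setI0 // cards0 !subn0.
  by have := @card_Ntwice_ge q p; lia.
have := subset_leq_card U; rewrite cardsU.
(* As [1 < p <= q < n], the intersection has at most [q - p] elements, and the union at least
   [q + (n - p + 1) - (q - p) = n + 1]. *)
have -> : Ninside e xs 1 q :&: Ninside e xs p n = Ninside e xs p q.
  have p1 : 1 <= p by lia.
  apply/setP=> y; rewrite inE !Ninside_nbr //.
  case: (boolP (y \in _)) => //= yY.
  by have := first_nbr_bounds yY; have := last_nbr_le yY; lia.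
by have := @card_Ninside_mid p q; lia.
Qed.

(** * Hall's condition for the three possible sizes of Y *)

Local Notation hall_from s0 :=
  (hall (Yside xs) release deadline s0 (s0 + #|Yside xs|)).

Lemma deadline_ge y : y \in Yside xs -> 1 <= deadline y.
Proof.
by move=> yY; rewrite /deadline; have := first_nbr_bounds yY; case: ifP; lia.
Qed.

(** According to which end of the window is void, the jobs counted lie inside all of X, a prefix, a
    suffix or an inner interval. Omitting slot 0 costs prefixes one slot and omitting slot [n] costs
    suffixes one; the last two hypotheses make up for this. *)
Lemma hall_from_prefix_suffix s0 :
    s0 <= 1 -> s0 + #|Yside xs| <= n.+1 -> n <= s0 + #|Yside xs| ->
    (s0 = 1 -> forall q, 1 <= q < n -> #|Ninside e xs 1 q| < q) ->
    (s0 + #|Yside xs| = n -> forall p, 1 < p <= n ->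
       #|Ninside e xs p n| <= n - p) ->
  hall_from s0.
Proof.
move=> hs hE hE' pre suf u v su uv vE; set A := [set y in _ | _].
have sub p q : 1 <= p ->
    (forall y, y \in Yside xs -> (u == s0) || (u <= release y) ->
       (v == s0 + #|Yside xs|) || (deadline y <= v) ->
       p <= first_nbr y /\ last_nbr y <= q) ->
    #|A| <= #|Ninside e xs p q|.
  move=> p1 h; apply/subset_leq_card/subsetP=> y.
  rewrite in_set => /and3P[yY hu hv]; rewrite Ninside_nbr // yY /=.
  by have [-> ->] := h y yY hu hv.
have empty (p q : nat) : 1 <= p -> q < p -> #|Ninside e xs p q| = 0.
  move=> p1 qp; apply/eqP; rewrite cards_eq0; apply/set0Pn=> -[y].
  by rewrite Ninside_nbr // => /and3P[/first_nbr_bounds]; lia.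
case: (eqVneq u s0) => hu; case: (eqVneq v (s0 + #|Yside xs|)) => hv.
- have : #|A| <= #|Yside xs|.
    by apply/subset_leq_card/subsetP=> y; rewrite in_set => /andP[].
  by lia.
(* Here [v <= n], so the deadline [n + 1] is excluded and the last neighbour comes before [x_n]. *)
- have : #|A| <= #|Ninside e xs 1 (minn v n.-1)|.
    apply: sub => // y yY _; rewrite (negPf hv) /= /deadline => h.
    have := first_nbr_bounds yY; have := last_nbr_le yY.
    by move: h; case: eqP; lia.
  case: (posnP (minn v n.-1)) => [->|h]; first by rewrite empty //; lia.
  have := @card_Ninside_prefix (minn v n.-1).
  by case: (eqVneq s0 1) => h1; [have := pre h1 (minn v n.-1) |]; lia.
(* Here [u >= 1], so the release time 0 is excluded and the first neighbour comes after [x_1]. *)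
- have : #|A| <= #|Ninside e xs (maxn u 2) n|.
    apply: sub => // [|y yY]; first lia.
    rewrite (negPf hu) /= /release => h _.
    have := first_nbr_bounds yY; have := last_nbr_le yY.
    by move: h; case: eqP; lia.
  case: (ltnP n (maxn u 2)) => h; first by rewrite empty //; lia.
  have := @card_Ninside_suffix (maxn u 2).
  by case: (eqVneq (s0 + #|Yside xs|) n) => h1;
    [have := suf h1 (maxn u 2) |]; lia.
have : #|A| <= #|Ninside e xs (maxn u 2) (minn v n.-1)|.
  apply: sub => [|y yY]; first lia.
  rewrite (negPf hu) (negPf hv) /= /release /deadline => h h'.
  have := first_nbr_bounds yY; have := last_nbr_le yY.
  by move: h h'; case: eqP; case: eqP; lia.
case: (ltnP (minn v n.-1) (maxn u 2)) => h; first by rewrite empty //; lia.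
by have := @card_Ninside_mid (maxn u 2) (minn v n.-1); lia.
Qed.

Lemma hall_large : #|Yside xs| = n.+1 -> hall_from 0.
Proof. by move=> cY; apply: hall_from_prefix_suffix; lia. Qed.

Lemma hall_small : #|Yside xs| < n -> hall_from 1.
Proof.
move=> cY; have := card_Yside_ge => cY'; apply: hall_from_prefix_suffix; try lia.
  by move=> _ q hq; have := @card_Ninside_few 1 q q n; lia.
by move=> _ p hp; have := @card_Ninside_few p n 1 p; lia.
Qed.

(** From slot 1 only a tight prefix can obstruct; it excludes tight suffixes, the only obstruction
    from slot 0. *)
Lemma hall_medium : #|Yside xs| = n -> ~ hall_from 1 -> hall_from 0.
Proof.
move=> cY nH.
have [/existsP[q /and3P[q1 qn tq]]|] :=
  boolP [exists q : 'I_n, [&& 1 <= q, q < n & q <= #|Ninside e xs 1 q|]].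
  apply: hall_from_prefix_suffix; try lia.
  by move=> _ p hp; apply: (@tight_prefix_suffix p q) => //; lia.
rewrite negb_exists => /forallP none; case: nH.
apply: hall_from_prefix_suffix; try lia.
move=> _ q hq; have qn : q < n by lia.
by have := none (Ordinal qn); rewrite /=; lia.
Qed.

(** This is why scanning the neighbours of [x_s] finds every job released by slot [s]. For [s = 0]
    the truncated [s.-1] selects [x_1], whose neighbours are those released at 0. *)
Lemma slot_adjacent x0 y s : y \in Yside xs -> s <= n -> s < deadline y ->
  (release y <= s) = e y (nth x0 xs s.-1).
Proof.
move=> yY sn; have := first_nbr_bounds yY; have := last_nbr_le yY.
rewrite nbr_interval /release /deadline; [|by []|lia].
by do 2!case: ifP; lia.
Qed.

Lemma slot_adjacent_next x0 y s :
  y \in Yside xs -> s < n -> release y <= s < deadline y -> e y (nth x0 xs s).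
Proof.
move=> yY sn; have := first_nbr_bounds yY; have := last_nbr_le yY.
by rewrite nbr_interval /release /deadline //; do 2!case: ifP; lia.
Qed.

(* The entry of y in the table of deadlines once x_1, ..., x_i have overwritten
   the entries of their neighbours in this order. *)
Fixpoint sweep (i : nat) (y : V) : nat :=
  if i is j.+1 then
    if e (nth y xs j) y then i + (i == n) else sweep j y
  else 0.

Lemma sweep_le i y : i <= n -> sweep i y <= n.+1.
Proof. by elim: i => //= i IH hi; case: ifP => _; [lia | apply: IH; lia]. Qed.

Lemma sweep_deadline y : y \in Yside xs -> sweep n y = deadline y.
Proof.
move=> yY; have := first_nbr_bounds yY; have := last_nbr_le yY => hl hf.
(* Neighbourhoods being intervals, the last neighbour met so far sits at [minn i (last_nbr y)]; the
   Boolean adds 1 exactly at [x_n]. *)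
have E i : i <= n -> sweep i y =
    if first_nbr y <= i then minn i (last_nbr y) + (minn i (last_nbr y) == n)
    else 0.
  elim: i => [|i IH] hi /=; first by [].
  case: (CB) => -[sym _] _ _ _ _.
  rewrite sym nbr_interval // IH; last lia.
  by do !case: ifP; lia.
by rewrite E // /deadline; do 2!case: ifP; lia.
Qed.

(** In the sequence slot 0, [x_1], slot 1, [x_2], ... even indices are slots and odd ones elements
    of X; [s0 = 1] drops slot 0. *)
Definition slot_path (x0 : V) (pk : nat -> V) (s0 k : nat) : V :=
  if odd (k + s0) then nth x0 xs (k + s0)./2 else pk (k + s0)./2.

Lemma card_V : #|V| = n + #|Yside xs|.
Proof.
case: (CB) => _ _ Uxs _ _; rewrite -(card_uniqP Uxs) -(cardC (mem xs)).
by congr (_ + _); apply: eq_card => y; rewrite !inE.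
Qed.

Lemma slot_path_hamiltonian x0 pk s0 :
    s0 <= 1 -> s0 + #|Yside xs| <= n.+1 -> n <= s0 + #|Yside xs| ->
    earliest_deadline (Yside xs) release deadline s0 pk (s0 + #|Yside xs|) ->
  hamiltonian_path e (mkseq (slot_path x0 pk s0) #|V|).
Proof.
move=> hs hE hE' ED; have cV := card_V.
case: (CB) => -[sym _] _ Uxs _ _.
have slot k : k < #|V| -> ~~ odd (k + s0) ->
    s0 <= (k + s0)./2 < s0 + #|Yside xs| by lia.
have pos k : k < #|V| -> odd (k + s0) -> (k + s0)./2 < n by lia.
have U : uniq (mkseq (slot_path x0 pk s0) #|V|).
  apply/mkseq_uniqP=> k l; rewrite !inE => hk hl; rewrite /slot_path.
  case: ifPn => ok; case: ifPn => ol E.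
  - by have := uniqP x0 Uxs _ _ (pos k hk ok) (pos l hl ol) E; lia.
  - have [[pY _] _ _] := ED _ (slot l hl ol).
    by move: pY; rewrite -E inE mem_nth ?pos.
  - have [[pY _] _ _] := ED _ (slot k hk ok).
    by move: pY; rewrite E inE mem_nth ?pos.
  - by have := earliest_deadline_inj ED (slot k hk ok) (slot l hl ol) E; lia.
split=> // [|v].
  apply/(sortedP x0) => k; rewrite size_mkseq => hk.
  rewrite !nth_mkseq //; last lia; rewrite /slot_path addSn /=.
  case ok : (odd (k + s0)) => /=.
    rewrite sym.
    have hl : ~~ odd (k.+1 + s0) by rewrite addSn /= ok.
    have [[pY _] hr _] := ED _ (slot _ hk hl).
    rewrite addSn /= in pY hr *.
    have hn := @pos k (ltnW hk) ok.
    have := @slot_adjacent x0 _ (uphalf (k + s0)) pY.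
    by rewrite (_ : (uphalf _).-1 = (k + s0)./2); lia.
  have hl : k < #|V| by lia.
  have [[pY _] hr _] := ED _ (slot _ hl (negbT ok)).
  have := @slot_adjacent_next x0 _ (k + s0)./2 pY.
  have := pos k.+1 hk; rewrite addSn /= ok => /(_ isT).
  rewrite (_ : uphalf _ = (k + s0)./2); last by lia.
  by move=> hp; apply.
(* The path has [#|V|] distinct vertices, so a missed one would give [#|V| + 1]. *)
apply/negPn/negP=> nv.
have : uniq (v :: mkseq (slot_path x0 pk s0) #|V|) by rewrite /= nv.
move/card_uniqP/esym/eq_leq/leq_trans/(_ (max_card _)).
by rewrite /= size_mkseq ltnn.
Qed.

End Monotone.

(** * Reasoning about costed runs *)

Section CostedTriples.

Variable w : nat.

(** Together with [fits] this splits [eval] into an unguarded result and an overflow condition,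
    which reduces runs to arithmetic goals. *)
Fixpoint value (st : state) (ex : exp) : nat :=
  match ex with
  | Const v => v
  | Var x => vars st x
  | Get a i => arrs st a (value st i)
  | Bin o e1 e2 => eval_binop o (value st e1) (value st e2)
  end.

Fixpoint fits (st : state) (ex : exp) : Prop :=
  match ex with
  | Const v => v < w
  | Var x => vars st x < w
  | Get a i => fits st i /\ arrs st a (value st i) < w
  | Bin o e1 e2 =>
      [/\ fits st e1, fits st e2 & eval_binop o (value st e1) (value st e2) < w]
  end.

Definition yields (st : state) (ex : exp) (v : nat) : Prop :=
  fits st ex /\ value st ex = v.

Lemma yieldsP st ex v : yields st ex v -> eval w st ex = Some v.
Proof.
case=> + <-; elim: ex => [c|x|a i IH|o e1 IH1 e2 IH2] /=; rewrite /word.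
- by move=> ->.
- by move=> ->.
- by case=> /IH -> /= ->.
- by case=> /IH1 -> /IH2 -> /= ->.
Qed.

Definition runs (c : cmd) (st : state) (T : nat) (Q : state -> Prop) : Prop :=
  exists t st', [/\ exec w c st t st', t <= T & Q st'].

Lemma runs_weaken c st T T' (Q Q' : state -> Prop) :
  runs c st T' Q' -> T' <= T -> (forall st', Q' st' -> Q st') -> runs c st T Q.
Proof.
by case=> t [st' [h ht hq]] hT hQ; exists t, st'; split; [|lia|apply: hQ].
Qed.

Lemma runs_skip st T (Q : state -> Prop) : 0 < T -> Q st -> runs Skip st T Q.
Proof. by move=> hT hQ; exists 1, st; split=> //; apply: exec_skip. Qed.

Lemma runs_set_var x ex v st T (Q : state -> Prop) :
  yields st ex v -> (exp_cost ex).+1 <= T -> Q (put_var st x v) ->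
  runs (Set_var x ex) st T Q.
Proof.
by move=> /yieldsP h hT hQ; do 2!eexists; split; [apply: exec_set_var h | |].
Qed.

Lemma runs_set_arr a e1 e2 i v st T (Q : state -> Prop) :
  yields st e1 i -> yields st e2 v -> (exp_cost e1 + exp_cost e2).+1 <= T ->
  Q (put_arr st a i v) -> runs (Set_arr a e1 e2) st T Q.
Proof.
move=> /yieldsP h1 /yieldsP h2 hT hQ.
by do 2!eexists; split; [apply: exec_set_arr h1 h2 | |].
Qed.

Lemma runs_seq c1 c2 st T T1 (Q : state -> Prop) :
  runs c1 st T1 (fun st1 => runs c2 st1 (T - T1.+1) Q) -> T1 < T ->
  runs (Seq c1 c2) st T Q.
Proof.
case=> t1 [st1 [h1 ht1 [t2 [st2 [h2 ht2 hQ]]]]] hT.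
by do 2!eexists; split; [apply: exec_seq h1 h2 | lia |].
Qed.

Lemma runs_seq_var x ex v c st T (Q : state -> Prop) :
  yields st ex v -> exp_cost ex + 2 <= T ->
  runs c (put_var st x v) (T - (exp_cost ex + 2)) Q ->
  runs (Seq (Set_var x ex) c) st T Q.
Proof.
move=> h hT hQ; apply: (@runs_seq _ _ _ _ (exp_cost ex).+1); last lia.
by apply: (runs_set_var h) => //; rewrite -addn2.
Qed.

Lemma runs_seq_arr a e1 e2 i v c st T (Q : state -> Prop) :
  yields st e1 i -> yields st e2 v -> exp_cost e1 + exp_cost e2 + 2 <= T ->
  runs c (put_arr st a i v) (T - (exp_cost e1 + exp_cost e2 + 2)) Q ->
  runs (Seq (Set_arr a e1 e2) c) st T Q.
Proof.
move=> h h' hT hQ.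
apply: (@runs_seq _ _ _ _ (exp_cost e1 + exp_cost e2).+1); last lia.
by apply: (runs_set_arr h h') => //; rewrite -addn2.
Qed.

Lemma runs_if ex v c1 c2 st T (Q : state -> Prop) :
  yields st ex v -> exp_cost ex < T ->
  (v != 0 -> runs c1 st (T - (exp_cost ex).+1) Q) ->
  (v = 0 -> runs c2 st (T - (exp_cost ex).+1) Q) ->
  runs (If ex c1 c2) st T Q.
Proof.
move=> /yieldsP h hT h1 h2; case: (eqVneq v 0) => hv.
  have [t [st' [ht le_t hQ]]] := h2 hv; rewrite hv in h.
  by do 2!eexists; split; [apply: exec_if_false h ht | lia |].
have [t [st' [ht le_t hQ]]] := h1 hv.
by do 2!eexists; split; [apply: exec_if_true h hv ht | lia |].
Qed.

(** The budget [f i] may vary with the round, so that scans of adjacency lists sum to the total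
    degree; the guard is evaluated [K + 1] times. *)
Lemma runs_while ex c (I : nat -> state -> Prop) (f : nat -> nat) K T st :
  (forall i st', i < K -> I i st' ->
     (exists2 v, yields st' ex v & v != 0) /\ runs c st' (f i) (I i.+1)) ->
  (forall st', I K st' -> yields st' ex 0) ->
  \sum_(i < K) f i + (exp_cost ex).+1 * K.+1 <= T ->
  I 0 st -> runs (While ex c) st T (I K).
Proof.
move=> body stop; elim: K I f T st body stop => [|K IH] I f T st body stop hT h0.
  do 2!eexists; split; [apply: exec_while_false (yieldsP (stop _ h0)) | | by []].
  by move: hT; rewrite big_ord0; lia.
have [[v /yieldsP hv nz] [t1 [st1 [h1 ht1 I1]]]] := body 0 st isT h0.
rewrite big_ord_recl /= in hT.
have [||||t2 [st2 [h2 ht2 I2]]] :=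
    IH (fun i => I i.+1) (fun i => f i.+1)
       (\sum_(i < K) f i.+1 + (exp_cost ex).+1 * K.+1) st1.
- by move=> i st' hi; apply: body.
- by [].
- by [].
- by [].
exists (exp_cost ex + t1 + t2).+1, st2; split=> //; last first.
  by move: hT ht1 ht2; rewrite /bump /=; under eq_bigr do rewrite add1n; nia.
exact: exec_while_true hv nz h1 h2.
Qed.

End CostedTriples.

(** * Layout of the input *)

Section Reader.

Variables (N : nat) (xs : seq 'I_N) (adj : 'I_N -> seq 'I_N).

Local Notation n := (size xs).

(** Input position of the degree of [v]: the header takes [n + 2] cells, every block its degree plus
    one. *)
Definition offset (v : nat) : nat :=
  n + 2 + sumn (take v [seq (size (adj u)).+1 | u <- enum 'I_N]).

Definition degree_sum : nat := \sum_v size (adj v).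

Definition encode_length : nat := n + 2 + N + degree_sum.

Lemma nth_flatten_offset (T : Type) (x0 : T) (ss : seq (seq T)) i j :
  i < size ss -> j < size (nth [::] ss i) ->
  nth x0 (flatten ss) (sumn (take i (map size ss)) + j) = nth x0 (nth [::] ss i) j.
Proof.
elim: ss i => //= s ss IH [|i] /= hi hj; first by rewrite add0n nth_cat hj.
by rewrite nth_cat ifF -?addnA ?addKn ?IH //; lia.
Qed.

Lemma offsetS (v : 'I_N) : offset v.+1 = offset v + (size (adj v)).+1.
Proof.
rewrite /offset (take_nth 0); last by rewrite size_map size_enum_ord.
rewrite -cats1 sumn_cat /= addn0.
by rewrite (nth_map v) ?size_enum_ord // nth_ord_enum addnA.
Qed.

Lemma encode_order x0 i :
  i < n -> nth 0 (encode xs adj) i.+2 = nth x0 xs i.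
Proof. by move=> hi; rewrite /= nth_cat size_map hi (nth_map x0). Qed.

Lemma encode_block (v : 'I_N) j : j <= size (adj v) ->
  nth 0 (encode xs adj) (offset v + j) =
  nth 0 (size (adj v) :: map val (adj v)) j.
Proof.
move=> hj; rewrite /encode nth_cat /= size_map ifF /offset; last lia.
rewrite (_ : _ + _ + j - _ =
  sumn (take v [seq (size (adj u)).+1 | u <- enum 'I_N]) + j); last lia.
pose b (v : 'I_N) := size (adj v) :: map val (adj v).
rewrite (_ : map _ _ = map size (map b (enum 'I_N))); last first.
  by rewrite -map_comp; apply: eq_map => u; rewrite /= size_map.
have hv : v < size (map b (enum 'I_N)) by rewrite size_map size_enum_ord.
have Eb : nth [::] (map b (enum 'I_N)) v = b v.
  by rewrite (nth_map v) ?size_enum_ord // nth_ord_enum.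
by rewrite nth_flatten_offset ?Eb //= size_map.
Qed.

Lemma encode_degree (v : 'I_N) :
  nth 0 (encode xs adj) (offset v) = size (adj v).
Proof. by rewrite -[offset v]addn0 encode_block. Qed.

Lemma encode_neighbour x0 (v : 'I_N) j : j < size (adj v) ->
  nth 0 (encode xs adj) (offset v + j.+1) = nth x0 (adj v) j.
Proof. by move=> hj; rewrite encode_block //= (nth_map x0). Qed.

Lemma offset_bound (v : 'I_N) :
  offset v + (size (adj v)).+1 <= encode_length.
Proof.
rewrite -offsetS /offset /encode_length -!addnA !leq_add2l.
have -> : N + degree_sum = sumn [seq (size (adj u)).+1 | u <- enum 'I_N].
  rewrite /degree_sum sumnE big_map big_enum /=.
  under [RHS]eq_bigr do rewrite -addn1.
  by rewrite big_split /= sum1_card card_ord addnC.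
by rewrite -{2}[map _ _](cat_take_drop v.+1) sumn_cat leq_addr.
Qed.

Lemma encode_length_ge : n + 2 + N + degree_sum <= encode_length.
Proof. exact: leqnn. Qed.

End Reader.

(** * The program *)

(* [vp] is a position in the input, [vd] a degree, [vl] a deadline, [vs0] the
   first slot, [vk] a position on the path, [vs] a slot and [vb], [vdb] the best
   vertex so far for it with its deadline.  [aUsed] holds [vs0] + 1 at the used
   vertices, so that a second greedy run can start without erasing it. *)
Local Notation vN := 0 (only parsing).
Local Notation vn := 1 (only parsing).
Local Notation vi := 2 (only parsing).
Local Notation vp := 3 (only parsing).
Local Notation vj := 4 (only parsing).
Local Notation vd := 5 (only parsing).
Local Notation vl := 6 (only parsing).
Local Notation vs0 := 7 (only parsing).
Local Notation vk := 8 (only parsing).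
Local Notation vs := 9 (only parsing).
Local Notation vy := 10 (only parsing).
Local Notation vb := 11 (only parsing).
Local Notation vdb := 12 (only parsing).
Local Notation vfail := 13 (only parsing).
Local Notation aIn := 0 (only parsing).
Local Notation aOut := 1 (only parsing).
Local Notation aOff := 2 (only parsing).
Local Notation aDl := 3 (only parsing).
Local Notation aUsed := 4 (only parsing).

Declare Scope exp_scope.
Delimit Scope exp_scope with E.
Local Notation "a + b" := (Bin OAdd a b) : exp_scope.
Local Notation "a - b" := (Bin OSub a b) : exp_scope.
Local Notation "a * b" := (Bin OMul a b) : exp_scope.
Local Notation "a %/ b" := (Bin ODiv a b) : exp_scope.
Local Notation "a %% b" := (Bin OMod a b) : exp_scope.
Local Notation "a == b" := (Bin OEq a b) : exp_scope.
Local Notation "a < b" := (Bin OLt a b) : exp_scope.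
Local Notation "x ::= a" := (Set_var x a%E) (at level 75).
Local Notation "c1 ;; c2" := (Seq c1 c2) (at level 80, right associativity).

(** Blocks have varying lengths; recording their starts in one pass gives constant-time access to
    each list. *)
Definition offsets_body : cmd :=
  Set_arr aOff (Var vi) (Var vp) ;;
  vp ::= Var vp + Get aIn (Var vp) + Const 1 ;;
  vi ::= Var vi + Const 1.

Definition offsets_prog : cmd :=
  vi ::= Const 0 ;;
  vp ::= Var vn + Const 2 ;;
  While (Var vi < Var vN)%E offsets_body.

Definition sweep_visit : cmd :=
  vj ::= Var vj + Const 1 ;;
  Set_arr aDl (Get aIn (Var vp + Var vj)%E) (Var vl).

Definition sweep_body : cmd :=
  vp ::= Get aOff (Get aIn (Var vi + Const 2)%E) ;;
  vd ::= Get aIn (Var vp) ;;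
  vl ::= Var vi + Const 1 + (Var vi + Const 1 == Var vn) ;;
  vj ::= Const 0 ;;
  While (Var vj < Var vd)%E sweep_visit ;;
  vi ::= Var vi + Const 1.

Definition sweep_prog : cmd :=
  vi ::= Const 0 ;; While (Var vi < Var vn)%E sweep_body.

(** On truth values [1 - b] is negation and the product conjunction. As [vdb] starts at [n + 2],
    above all deadlines, the first fitting vertex is accepted. *)
Definition slot_visit : cmd :=
  vj ::= Var vj + Const 1 ;;
  vy ::= Get aIn (Var vp + Var vj)%E ;;
  If ((Const 1 - (Get aUsed (Var vy) == Var vs0 + Const 1))
      * ((Var vs < Get aDl (Var vy)) * (Get aDl (Var vy) < Var vdb)))%E
     (vb ::= Var vy ;; vdb ::= Get aDl (Var vy))
     Skip.

(* The value N of [vb] means that no vertex fits the slot.  The truncated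
   subtraction lets slot 0 scan the neighbours of x_1, as slot 1 does. *)
Definition slot_body : cmd :=
  vs ::= (Var vk + Var vs0) %/ Const 2 ;;
  vp ::= Get aOff (Get aIn (Var vs - Const 1 + Const 2)%E) ;;
  vd ::= Get aIn (Var vp) ;;
  vb ::= Var vN ;;
  vdb ::= Var vn + Const 2 ;;
  vj ::= Const 0 ;;
  While (Var vj < Var vd)%E slot_visit ;;
  Set_arr aUsed (Var vb) (Var vs0 + Const 1)%E ;;
  Set_arr aOut (Var vk + Const 1)%E (Var vb) ;;
  If (Var vb == Var vN)%E (vfail ::= Const 1) Skip.

Definition greedy_body : cmd :=
  If ((Var vk + Var vs0) %% Const 2)%E
     (Set_arr aOut (Var vk + Const 1)%E
        (Get aIn ((Var vk + Var vs0) %/ Const 2 + Const 2)%E))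
     slot_body ;;
  vk ::= Var vk + Const 1.

Definition greedy_prog : cmd :=
  vfail ::= Const 0 ;;
  vk ::= Const 0 ;;
  While (Var vk < Var vN)%E greedy_body.

(** The answer is always positive. The test [N < 2n + 1] means [|Y| <= n] and makes 1 the first
    slot. For [n = 0] the zero-initialised output already names the only vertex. *)
Definition ham_prog : cmd :=
  vN ::= Get aIn (Const 0) ;;
  vn ::= Get aIn (Const 1) ;;
  If (Var vn)
     (offsets_prog ;; sweep_prog ;;
      vs0 ::= Var vN < Var vn + Var vn + Const 1 ;;
      greedy_prog ;;
      If (Var vfail) (vs0 ::= Const 0 ;; greedy_prog) Skip)
     Skip ;;
  Set_arr aOut (Const 0) (Const 1).

(** * Correctness and running time *)

Section Phases.

Variables (N : nat) (e : rel 'I_N) (xs : seq 'I_N) (adj : 'I_N -> seq 'I_N).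
Variables (x0 : 'I_N) (w : nat).

Local Notation n := (size xs).
Local Notation total := (encode_length xs adj).
Local Notation off := (offset xs adj).

Hypotheses (w_ge : 4 * total + 20 <= w) (Uxs : uniq xs).
Hypothesis adjP : adjacency_lists e adj.

Definition input (st : state) : Prop :=
  [/\ forall i, arrs st aIn i = nth 0 (encode xs adj) i, vars st vN = N
    & vars st vn = n].

Lemma size_xs_le : n <= N.
Proof. by rewrite -(card_uniqP Uxs) -[leqRHS](card_ord N) max_card. Qed.

Lemma offsets_progP st Q T : input st -> 40 * N + 40 <= T ->
  (forall st', input st' -> (forall v : 'I_N, arrs st' aOff v = off v) ->
     arrs st' aDl =1 arrs st aDl -> arrs st' aUsed =1 arrs st aUsed -> Q st') ->
  runs w offsets_prog st T Q.
Proof.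
move=> I0 hT hQ.
have nN := size_xs_le; have LB := encode_length_ge xs adj.
apply: (@runs_seq_var _ _ _ 0) => //; first by split=> //=; lia.
  by rewrite /=; lia.
case: (I0) => _ _ hn.
apply: (@runs_seq_var _ _ _ (n + 2)).
  by split; rewrite /= /upd /= hn //; split; lia.
  by rewrite /=; lia.
pose I i st' := [/\ input st', vars st' vi = i, vars st' vp = off i,
  forall v : 'I_N, v < i -> arrs st' aOff v = off v &
  arrs st' aDl =1 arrs st aDl /\ arrs st' aUsed =1 arrs st aUsed].
apply: (runs_weaken (Q' := I N) (T' := 30 * N + 30)); last 1 first.
- by move=> st' [i' _ _ hO [hD hU]]; apply: hQ => // v; apply: hO.
- apply: (runs_while (f := fun=> 20)); last 2 first.
  + by rewrite sum_nat_const card_ord /=; lia.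
  + by split=> //=; rewrite /upd /= /offset take0 addn0.
  + move=> i st' hi [I' vi' vp' hO [hD hU]]; case: (I') => hI hN hn'.
    have B := offset_bound xs adj (Ordinal hi).
    have D := encode_degree xs adj (Ordinal hi).
    have OS := offsetS xs adj (Ordinal hi); rewrite /= in B D OS.
    split.
      by exists 1 => //; split; rewrite /= vi' hN hi //; split; lia.
    apply: (@runs_seq_arr _ _ _ _ i (off i));
      try by split; rewrite /= ?vi' ?vp' //; lia.
    apply: (@runs_seq_var _ _ _ (off i.+1)).
    - split; rewrite /= /upd /= vp' hI D ?OS; last lia.
      by do !split; lia.
    - by [].
    apply: (@runs_set_var _ _ _ i.+1) => //.
      by split; rewrite /= /upd /= vi'; [do !split; lia | lia].
    split=> // v; rewrite /= /upd /= ltnS => hv.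
    by case: eqP => [->//|ne]; apply: hO; lia.
  + move=> st' [[hI hN hn'] vi' vp' hO hh].
    by split; rewrite /= vi' hN ltnn //; do !split; lia.
- by rewrite /=; lia.
Qed.

(** * The table of deadlines *)

Definition indexed (st : state) : Prop :=
  input st /\ forall v : 'I_N, arrs st aOff v = off v.

(** The [x_i] are distinct, so scanning each of their lists once stays linear. *)
Lemma sum_degree_xs : \sum_(i < n) size (adj (nth x0 xs i)) <= degree_sum adj.
Proof.
have -> : \sum_(i < n) size (adj (nth x0 xs i)) = \sum_(v <- xs) size (adj v).
  by rewrite (big_nth x0) big_mkord.
rewrite big_uniq //.
by rewrite /degree_sum [leqRHS](bigID (mem xs)) /= leq_addr.
Qed.

Lemma sweep_bodyP i st :
  i < n -> indexed st -> vars st vi = i ->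
  (forall y : 'I_N, arrs st aDl y = sweep e xs i y) ->
  runs w sweep_body st (40 + 20 * size (adj (nth x0 xs i))) (fun st' =>
    [/\ indexed st', vars st' vi = i.+1,
        forall y : 'I_N, arrs st' aDl y = sweep e xs i.+1 y &
        arrs st' aUsed =1 arrs st aUsed]).
Proof.
move=> hi I0 i0 hD0; have nN := size_xs_le; have LB := encode_length_ge xs adj.
set x := nth x0 xs i.
case: (I0) => -[hI hN hn] hO.
have B := offset_bound xs adj x; have D := encode_degree xs adj x.
have X := encode_order adj x0 hi; rewrite -/x in X.
apply: (@runs_seq_var _ _ _ (off x)).
- split; rewrite /= i0 hI addn2 X ?hO //.
  by have := ltn_ord x; do !split; lia.
- by rewrite /=; lia.
apply: (@runs_seq_var _ _ _ (size (adj x))).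
- by split; rewrite /= /upd /= hI D //; split; lia.
- by rewrite /=; lia.
apply: (@runs_seq_var _ _ _ (i.+1 + (i.+1 == n))).
- by split; rewrite /= /upd /= i0 hn; [do !split; lia | lia].
- by rewrite /=; lia.
apply: (@runs_seq_var _ _ _ 0); [by split=> //=; lia | by rewrite /=; lia |].
pose J j st' := [/\ indexed st' /\ vars st' vi = i,
  vars st' vp = off x /\ vars st' vd = size (adj x),
  vars st' vl = i.+1 + (i.+1 == n) /\ vars st' vj = j,
  forall y : 'I_N, arrs st' aDl y =
    if y \in take j (adj x) then i.+1 + (i.+1 == n) else sweep e xs i y &
  arrs st' aUsed =1 arrs st aUsed].
apply: (@runs_seq _ _ _ _ _ (16 * size (adj x) + 4)); last by rewrite /=; lia.
apply: (runs_weaken (Q' := J (size (adj x))) (T' := 16 * size (adj x) + 4)) => //.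
  apply: (runs_while (f := fun=> 12)); last 2 first.
  - by rewrite sum_nat_const card_ord /=; lia.
  - by split=> // y; rewrite take0 /= /upd /= hD0.
  - move=> j st' hj [[[[hI' hN' hn'] hO'] i'] [p' d'] [l' j'] hD' hU']; split.
      by exists 1 => //; split; rewrite /= j' d' hj //; split; lia.
    apply: (@runs_seq_var _ _ _ j.+1) => //.
      by split; rewrite /= j'; [do !split; lia | lia].
    have Nb := encode_neighbour xs x0 hj.
    apply: (@runs_set_arr _ _ _ _ (nth x0 (adj x) j) (i.+1 + (i.+1 == n))) => //.
    + split; rewrite /= /upd /= p' hI' Nb //.
      by have := ltn_ord (nth x0 (adj x) j); do !split; lia.
    + by split; rewrite /= /upd /= l' //; lia.
    split=> // y; rewrite /= /upd /=.
    rewrite (take_nth x0) // mem_rcons inE.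
    case: (eqVneq y) => [->|ne]; first by rewrite eqxx.
    by rewrite hD'; case: eqP => // E; case/eqP: ne; apply: val_inj.
  - move=> st' [[[[hI' hN' hn'] hO'] i'] [p' d'] [l' j'] hD' hU'].
    by split; rewrite /= j' d' ltnn //; split; lia.
move=> st' [[I' i'] [p' d'] [l' j'] hD' hU'].
apply: (@runs_set_var _ _ _ i.+1).
- by split; rewrite /= i'; [do !split; lia | lia].
- by rewrite /=; lia.
split=> // y; rewrite /= hD' take_size.
(* [sweep] reads [xs] with default [y], whereas [x] uses [x0]; they agree since [i < n]. *)
have [_ ->] := adjP x; rewrite /x (set_nth_default y) //.
Qed.

Lemma sweep_progP st Q T :
  indexed st -> (forall y : 'I_N, arrs st aDl y = 0) ->
  60 * N + 20 * degree_sum adj + 60 <= T ->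
  (forall st', indexed st' -> (forall y : 'I_N, arrs st' aDl y = sweep e xs n y) ->
     arrs st' aUsed =1 arrs st aUsed -> Q st') ->
  runs w sweep_prog st T Q.
Proof.
move=> I0 D0 hT hQ; have nN := size_xs_le; have LB := encode_length_ge xs adj.
apply: (@runs_seq_var _ _ _ 0); first by split=> //=; lia.
  by rewrite /=; lia.
pose I i st' := [/\ indexed st', vars st' vi = i,
    forall y : 'I_N, arrs st' aDl y = sweep e xs i y &
    arrs st' aUsed =1 arrs st aUsed].
apply: (runs_weaken (Q' := I n)
          (T' := 50 * N + 20 * degree_sum adj + 50)); last 1 first.
- by move=> st' [I' _ D' U']; apply: hQ.
- apply: (runs_while
            (f := fun i => 40 + 20 * size (adj (nth x0 xs i)))); last 2 first.
  + rewrite big_split /= sum_nat_const card_ord -big_distrr /=.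
    by move: sum_degree_xs; set S := \sum_(i < n) _; nia.
  + by split.
  + move=> i st' hi [I' i' D' U']; case: (I') => -[hI hN hn] hO; split.
      by exists 1 => //; split; rewrite /= i' hn hi //; split; lia.
    apply: runs_weaken (sweep_bodyP hi I' i' D') _ _ => // st2 [I2 i2 D2 U2].
    by split=> // y; rewrite U2 U'.
  + move=> st' [[[hI hN hn] hO] i' D' U'].
    by split; rewrite /= i' hn ltnn //; split; lia.
- by rewrite /=; lia.
Qed.

(** * Filling one slot *)

Definition tabled (st : state) : Prop :=
  indexed st /\ forall y : 'I_N, arrs st aDl y = sweep e xs n y.

(** Adjacency to [x] replaces the test of release times, so [fit] checks only use and deadline. On
    failure the mark goes to cell [N], which belongs to no vertex. *)
Lemma slot_bodyP k s0 s st (x := nth x0 xs s.-1)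
    (fit := fun z : 'I_N => (arrs st aUsed z != s0.+1) && (s < sweep e xs n z)) :
  0 < n -> s0 <= 1 -> k < N -> k + s0 = s + s -> s <= n ->
  tabled st -> vars st vk = k -> vars st vs0 = s0 ->
  (forall v, arrs st aUsed v <= 2) ->
  runs w slot_body st (70 + 50 * size (adj x)) (fun st' =>
    exists b, [/\ tabled st', vars st' vk = k /\ vars st' vs0 = s0,
      arrs st' aOut =1 upd (arrs st aOut) k.+1 b,
      arrs st' aUsed =1 upd (arrs st aUsed) b s0.+1 &
      [/\ b = N, vars st' vfail = 1 & forall z, e x z -> ~~ fit z] \/
      exists y : 'I_N, [/\ b = y, vars st' vfail = vars st vfail, e x y, fit y &
        forall z, e x z -> fit z -> sweep e xs n y <= sweep e xs n z]]).
Proof.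
move=> n0 hs0 hk Ek hs T0 k0 st0 U0.
have nN := size_xs_le; have LB := encode_length_ge xs adj.
case: (T0) => -[[hI hN hn] hO] hD.
have B := offset_bound xs adj x; have D := encode_degree xs adj x.
have hs1 : s.-1 < n by lia.
have X := encode_order adj x0 hs1; rewrite -/x in X.
have [uA memA] := adjP x.
have Dle z : sweep e xs n z <= n.+1 by apply: sweep_le.
apply: (@runs_seq_var _ _ _ s).
- by split; rewrite /= k0 st0 ?Ek; [do !split; lia | lia].
- by rewrite /=; lia.
apply: (@runs_seq_var _ _ _ (off x)).
- have E : s - 1 + 2 = s.-1.+2 by lia.
  split; rewrite /= /upd /= hI E X ?hO //.
  by have := ltn_ord x; do !split; lia.
- by rewrite /=; lia.
apply: (@runs_seq_var _ _ _ (size (adj x))).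
- by split; rewrite /= /upd /= hI D //; split; lia.
- by rewrite /=; lia.
apply: (@runs_seq_var _ _ _ N).
- by split; rewrite /= /upd /= hN //; lia.
- by rewrite /=; lia.
apply: (@runs_seq_var _ _ _ (n + 2)).
- by split; rewrite /= /upd /= hn //; do !split; lia.
- by rewrite /=; lia.
apply: (@runs_seq_var _ _ _ 0).
- by split=> //=; lia.
- by rewrite /=; lia.
pose J j st' := [/\ tabled st',
  [/\ vars st' vk = k, vars st' vs0 = s0 & vars st' vs = s],
  [/\ vars st' vp = off x, vars st' vd = size (adj x), vars st' vj = j &
      vars st' vfail = vars st vfail],
  arrs st' aUsed = arrs st aUsed /\ arrs st' aOut = arrs st aOut &
  [/\ vars st' vb = N, vars st' vdb = n + 2 &
     forall z, z \in take j (adj x) -> ~~ fit z] \/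
  exists y : 'I_N, [/\ vars st' vb = y, vars st' vdb = sweep e xs n y,
     y \in take j (adj x), fit y &
     forall z, z \in take j (adj x) -> fit z -> sweep e xs n y <= sweep e xs n z]].
apply: (@runs_seq _ _ _ _ _ (44 * size (adj x) + 4)); last by rewrite /=; lia.
apply: (runs_weaken (Q' := J (size (adj x))) (T' := 44 * size (adj x) + 4)) => //.
  apply: (runs_while (f := fun=> 40)); last 2 first.
  - by rewrite sum_nat_const card_ord /=; lia.
  - by split=> //; left; split=> // z; rewrite take0.
  - move=> j st' hj [T' [k' s0' s'] [p' d' j' f'] [U' O'] C'].
    case: (T') => -[[hI' hN' hn'] hO'] hD'; split.
      by exists 1 => //; split; rewrite /= j' d' hj //; split; lia.
    have Nb := encode_neighbour xs x0 hj.
    set y := nth x0 (adj x) j in Nb.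
    have ty z : (z \in take j.+1 (adj x)) = (z == y) || (z \in take j (adj x)).
      by rewrite (take_nth x0) // mem_rcons inE.
    have bdle : vars st' vdb <= n + 2.
      by case: C' => [[_ ->]|[z [_ -> _ _ _]]] //; have := Dle z; lia.
    have yN := ltn_ord y; have yD := Dle y; have yU := U0 y.
    apply: (@runs_seq_var _ _ _ j.+1) => //.
      by split; rewrite /= j'; [do !split; lia | lia].
    apply: (@runs_seq_var _ _ _ y) => //.
      by split; rewrite /= /upd /= p' hI' Nb //; do !split; lia.
    apply: (@runs_if _ _ ((1 - (arrs st aUsed y == s0.+1)) *
        ((s < sweep e xs n y) * (sweep e xs n y < vars st' vdb)))) => //.
    + split; rewrite /= /upd /= U' s0' s' hD' addn1 //.
      by do !split; try lia; nia.
    + move=> hc.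
      have [fy lt_y] : fit y /\ sweep e xs n y < vars st' vdb.
        move: hc; rewrite /fit; case: (arrs st aUsed y == s0.+1) => //=.
        by case: (s < sweep e xs n y); case: (sweep e xs n y < vars st' vdb).
      apply: (@runs_seq_var _ _ _ y) => //.
        by split; rewrite /= /upd /= ?hD' //; lia.
      apply: (@runs_set_var _ _ _ (sweep e xs n y)) => //.
        by split; rewrite /= /upd /= hD' //; split; lia.
      split=> //; right; exists y; split=> //; first by rewrite ty eqxx.
      move=> z; rewrite ty => /orP[/eqP->//|zj] fz.
      case: C' => [[_ _ /(_ z zj)]|[y' [_ E _ _ /(_ z zj fz)]]]; first by rewrite fz.
      by move: lt_y; rewrite E; lia.
    + move=> hc; apply: runs_skip => //.
      have nf : fit y -> vars st' vdb <= sweep e xs n y.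
        rewrite /fit [vars st' vdb <= _]leqNgt; move/eqP: hc.
        case: (arrs st aUsed y == s0.+1) => //=.
        by case: (s < sweep e xs n y); case: (sweep e xs n y < vars st' vdb).
      split=> //; case: C' => [[b' db' nC]|[y' [b' db' y'j fy' best]]].
        left; split=> // z; rewrite ty => /orP[/eqP->|]; last exact: nC.
        apply/negP=> /nf; rewrite db'; lia.
      right; exists y'; split=> //; first by rewrite ty y'j orbT.
      move=> z; rewrite ty => /orP[/eqP->|]; last exact: best.
      by move/nf; rewrite db'.
  - move=> st' [[[[hI' hN' hn'] hO'] _] _ [_ d' j' _] _ _].
    by split; rewrite /= j' d' ltnn //; split; lia.
move=> st' [T' [k' s0' s'] [p' d' j' f'] [U' O']]; rewrite take_size => C'.
case: (T') => -[[hI' hN' hn'] hO'] hD'.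
set b := vars st' vb in C'.
have bN : b <= N by case: C' => [[-> _ _]|[y [-> _ _ _ _]]] //; apply: ltnW.
apply: (@runs_seq_arr _ _ _ _ b s0.+1).
- by split=> //=; rewrite -/b; lia.
- by split; rewrite /= s0'; [do !split; lia | lia].
- by rewrite /=; lia.
apply: (@runs_seq_arr _ _ _ _ k.+1 b).
- by split; rewrite /= k'; [do !split; lia | lia].
- by split=> //=; rewrite -/b; lia.
- by rewrite /=; lia.
apply: (@runs_if _ _ (b == N)).
- by split; rewrite /= hN' -/b //; do !split; lia.
- by rewrite /=; lia.
- move=> hb; have {hb} bE : b = N by case: (eqVneq b N) hb.
  apply: (@runs_set_var _ _ _ 1).
  + by split=> //=; lia.
  + by rewrite /=; lia.
  exists b; split=> //;
    [by move=> v; rewrite /= /upd /= O' | by move=> v; rewrite /= /upd /= U' |].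
  left; split=> // z ez.
  case: C' => [[_ _ ]|[y [Eb _ _ _ _]]]; first by apply; rewrite memA.
  by have := ltn_ord y; rewrite -Eb bE ltnn.
- move=> hb; apply: runs_skip; first by rewrite /=; lia.
  exists b; split=> //;
    [by move=> v; rewrite /= /upd /= O' | by move=> v; rewrite /= /upd /= U' |].
  right.
  case: C' => [[Eb]|[y [Eb _ yA fy best]]]; first by move: hb; rewrite Eb eqxx.
  exists y; split=> //; first by rewrite -memA.
  by move=> z ez; apply: best; rewrite memA.
Qed.

Hypotheses (CB : convex_bipartite e xs) (M : monotone_graph e xs) (n0 : 0 < n).

Local Notation Y := (Yside xs).
Local Notation hall_from s0 :=
  (hall Y (release e xs) (deadline e xs) s0 (s0 + #|Y|)).
Local Notation ED := (earliest_deadline Y (release e xs) (deadline e xs)).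

Lemma card_N : N = n + #|Y|.
Proof. by rewrite -(card_V CB) card_ord. Qed.

(** * One greedy run *)

Section Greedy.

Variables (s0 : nat) (st0 : state).

Hypotheses (hs0 : s0 <= 1) (hE : s0 + #|Y| <= n.+1) (hE' : n <= s0 + #|Y|).
Hypothesis used0 : forall v, arrs st0 aUsed v <= 2 /\ arrs st0 aUsed v <> s0.+1.

(** After [k] path positions the slots below [uphalf (k + s0)] are filled, and the marks [s0.+1] sit
    exactly on the vertices placed there. *)
Definition greedy_success (k : nat) (st : state) (pk : nat -> 'I_N) : Prop :=
  let s := uphalf (k + s0) in
  [/\ ED s0 pk s,
      forall j, s0 <= j < s -> arrs st aUsed (pk j) = s0.+1,
      forall y : 'I_N, arrs st aUsed y = s0.+1 -> exists2 j, s0 <= j < s & pk j = y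
    & forall k', k' < k -> arrs st aOut k'.+1 = slot_path xs x0 pk s0 k'].

(** After a failure the loop runs on and only the failure of Hall's condition is retained. The
    clause on marks is what a second run needs to start. *)
Definition greedy_inv (k : nat) (st : state) : Prop :=
  [/\ tabled st, vars st vk = k /\ vars st vs0 = s0,
      forall v, arrs st aUsed v = s0.+1 \/ arrs st aUsed v = arrs st0 aUsed v
    & (vars st vfail = 0 /\ exists pk, greedy_success k st pk) \/
      (vars st vfail = 1 /\ ~ hall_from s0)].

Definition slot_degree (t : nat) : nat :=
  if odd t then 0 else size (adj (nth x0 xs t./2.-1)).

Lemma greedy_path_step k st : k < N -> odd (k + s0) -> greedy_inv k st ->
  greedy_inv k.+1
    (put_var (put_arr st aOut k.+1 (nth x0 xs (k + s0)./2)) vk k.+1).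
Proof.
move=> hk ok [T0 [k0 st00] U0 R0]; split=> //.
case: R0 => [[f0 [pk [ED0 US SU O0]]]|[f0 nH]]; last by right.
left; split=> //; exists pk.
have hu : uphalf (k.+1 + s0) = uphalf (k + s0) by lia.
split; rewrite ?hu // => k'; rewrite ltnS leq_eqVlt /= /upd /= eqSS.
case: eqP => [-> _|_ /=]; last exact: O0.
by rewrite /slot_path ok.
Qed.

Lemma greedy_slot_step k s st st' b (x := nth x0 xs s.-1)
    (fit := fun z : 'I_N => (arrs st aUsed z != s0.+1) && (s < sweep e xs n z)) :
  k < N -> k + s0 = s + s -> greedy_inv k st ->
  tabled st' -> vars st' vk = k.+1 /\ vars st' vs0 = s0 ->
  arrs st' aOut =1 upd (arrs st aOut) k.+1 b ->
  arrs st' aUsed =1 upd (arrs st aUsed) b s0.+1 ->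
  [/\ b = N, vars st' vfail = 1 & forall z, e x z -> ~~ fit z] \/
  (exists y : 'I_N, [/\ b = y, vars st' vfail = vars st vfail, e x y, fit y &
        forall z, e x z -> fit z -> sweep e xs n y <= sweep e xs n z]) ->
  greedy_inv k.+1 st'.
Proof.
move=> hk Ek [T0 [k0 st00] U0 R0] T' ks' O' U' C'; have cN := card_N.
have hs : s0 <= s < s0 + #|Y| by lia.
have sn : s <= n by lia.
have xx : x \in xs by rewrite mem_nth //; case: (s) sn => // m.
case: (CB) => -[sym _] _ _ bip _.
have adjY z : e x z -> z \in Y by move/bip; rewrite xx inE; case: (z \in xs).
have swp := sweep_deadline CB n0.
have hu : uphalf (k + s0) = s by lia.
have hu' : uphalf (k.+1 + s0) = s.+1 by lia.
have odd' : odd (k + s0) = false by lia.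
have half' : (k + s0)./2 = s by lia.
have ge1 y : y \in Y -> s0 <= deadline e xs y by move/(deadline_ge CB n0); lia.
(* Every idle job that may run in slot [s] passes the program's test among the neighbours of [x]. *)
have idle_fit pk z : greedy_success k st pk -> idle Y s0 pk s z ->
    release e xs z <= s < deadline e xs z -> e x z /\ fit z.
  case; rewrite /= hu => _ _ SU _ [zY zI] hz.
  have [hz1 hz2] : release e xs z <= s /\ s < deadline e xs z by lia.
  split; first by rewrite sym -(slot_adjacent CB n0 x0 zY sn hz2).
  rewrite /fit swp // hz2 andbT; apply/eqP=> /SU[j hj].
  exact: zI.
split=> //.
  by move=> v; rewrite U' /upd; case: eqP => _; [left | apply: U0].
case: R0 => [[f0 [pk S0]]|[f0 nH]]; last first.
  by right; split=> //; case: C' => [[_ ->]|[y [_ -> _ _ _]]].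
case: C' => [[_ f1 none]|[y [Eb f' exy fy best]]].
  (* Under Hall's condition some idle job could run in slot [s], and the scan would have found
     it. *)
  right; split=> // H.
  have cY : #|Y| = s0 + #|Y| - s0 by lia.
  have EDs : ED s0 pk s by case: S0; rewrite /= hu.
  have [y [yI hy]] := earliest_deadline_step H cY ge1 hs EDs.
  by have [exy] := idle_fit pk y S0 yI hy; apply/negP/none.
left; split; first by rewrite f'.
exists (upd pk s y); case: (S0); rewrite /= hu => ED0 US SU O0.
have yY := adjY y exy.
have [fy1 fy2] : arrs st aUsed y <> s0.+1 /\ s < deadline e xs y.
  by move: fy; rewrite /fit swp // => /andP[/eqP].
have yI : idle Y s0 pk s y by split=> // j hj E; apply: fy1; rewrite -E US.
have hy : release e xs y <= s by rewrite (slot_adjacent CB n0 x0) // sym.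
have updE i : i < s -> upd pk s y i = pk i.
  by rewrite /upd; case: eqP => // ->; rewrite ltnn.
have updS : upd pk s y s = y by rewrite /upd eqxx.
rewrite /greedy_success hu'; split.
- apply: earliest_deadline_extend => //; first by rewrite hy.
  move=> z zI hz; have [exz fz] := idle_fit pk z S0 zI hz.
  by rewrite -!swp //; [apply: best | apply: adjY].
- move=> j hj; rewrite U' Eb /upd.
  case: (eqVneq j s) => [_|ne]; first by rewrite eqxx.
  by case: eqP => // _; apply: US; lia.
- move=> z; rewrite U' Eb /upd; case: eqP => [E _|_ /SU[j hj Ej]].
    by exists s; [lia | rewrite eqxx; apply/esym/val_inj].
  by exists j; [lia | case: eqP => // E; lia].
move=> k' hk'; rewrite O' Eb {1}/upd eqSS.
case: (eqVneq k' k) => [->|ne]; first by rewrite /slot_path odd' half' updS.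
rewrite O0; last lia.
rewrite /slot_path; case: ifP => // ok; rewrite updE //; lia.
Qed.

Lemma greedy_bodyP k st : k < N -> greedy_inv k st ->
  runs w greedy_body st (100 + 50 * slot_degree (k + s0)) (greedy_inv k.+1).
Proof.
move=> hk G0; case: (G0) => T0 [k0 st00] U0 R0; have cN := card_N.
have nN := size_xs_le; have LB := encode_length_ge xs adj.
case: (T0) => -[[hI hN hn] hO] hD.
have next st' : vars st' vk = k -> yields w st' (Var vk + Const 1)%E k.+1.
  by move=> E; split; rewrite /= E; [do !split; lia | lia].
set t := k + s0; have Ht : t = k + s0 by [].
apply: (@runs_seq _ _ _ _ _ (80 + 50 * slot_degree t)); last by lia.
apply: (@runs_if _ _ (t %% 2)).
- by split; rewrite /= k0 st00 //; rewrite -/t; do !split; lia.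
- by rewrite /=; lia.
- rewrite -/t => ht; have ot : odd t by lia.
  have lt_tn : t./2 < n by lia.
  have X := encode_order adj x0 lt_tn.
  have xN := ltn_ord (nth x0 xs t./2).
  apply: (@runs_set_arr _ _ _ _ k.+1 (nth x0 xs t./2)).
  + exact: next.
  + have E : t %/ 2 + 2 = t./2.+2 by lia.
    by split; rewrite /= k0 st00 -/t hI E X //; do !split; lia.
  + by rewrite /=; lia.
  apply: (@runs_set_var _ _ _ k.+1); first exact: next.
    by rewrite /=; lia.
  exact: greedy_path_step.
move=> ht; have ot : ~~ odd t by lia.
have Et : k + s0 = t./2 + t./2 by lia.
have U2 v : arrs st aUsed v <= 2.
  by case: (U0 v) => ->; [lia | case: (used0 v)].
have hs : t./2 <= n by lia.
apply: runs_weaken (slot_bodyP n0 hs0 hk Et hs T0 k0 st00 U2) _ _.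
  by rewrite /slot_degree (negPf ot) /=; lia.
move=> st' [b [T' [k' s0'] O' U' C']].
apply: (@runs_set_var _ _ _ k.+1); first exact: next.
  by rewrite /=; lia.
exact: (@greedy_slot_step k t./2 st (put_var st' vk k.+1) b).
Qed.

(** Slots 0 and 1 both scan [x_1], every other [x_i] is scanned at most once; hence the factor 2. *)
Lemma sum_slot_degree :
  \sum_(k < N) slot_degree (k + s0) <= 2 * degree_sum adj.
Proof.
have cN := card_N.
have E m : \sum_(t < m.*2.+1) slot_degree t =
    \sum_(s < m.+1) size (adj (nth x0 xs s.-1)).
  elim: m => [|m IH]; first by rewrite !big_ord1.
  rewrite doubleS big_ord_recr [in LHS]big_ord_recr /= IH.
  have odd0 : slot_degree m.*2.+1 = 0 by rewrite /slot_degree /= odd_double.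
  rewrite [RHS]big_ord_recr /= odd0 addn0; congr (_ + _).
  by rewrite /slot_degree /= negbK odd_double doubleK.
(* The run visits a window of the indices [0, ..., 2n]; [r] counts those after it. *)
have [r Er] : exists r, n.*2.+1 = s0 + (N + r).
  by exists (n.*2.+1 - (s0 + N)); lia.
have : \sum_(k < N) slot_degree (k + s0) <= \sum_(t < n.*2.+1) slot_degree t.
  rewrite Er big_split_ord /= (leq_trans _ (leq_addl _ _)) // big_split_ord /=.
  rewrite (leq_trans _ (leq_addr _ _)) //.
  by apply/eq_leq/eq_bigr => k _; rewrite addnC.
move/leq_trans; apply; rewrite E big_ord_recl /=.
have := sum_degree_xs; set S := \sum_(i < n) _.
rewrite mul2n -addnn => hS; apply: leq_add => //.
by apply: leq_trans hS; rewrite /S (bigD1 (Ordinal n0)) //= leq_addr.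
Qed.

Lemma greedy_progP T Q : tabled st0 -> vars st0 vs0 = s0 ->
  200 * N + 100 * degree_sum adj + 200 <= T ->
  (forall st, greedy_inv N st -> Q st) -> runs w greedy_prog st0 T Q.
Proof.
move=> T0 st00 hT hQ.
have nN := size_xs_le; have LB := encode_length_ge xs adj.
apply: (@runs_seq_var _ _ _ 0); [by split=> //=; lia | by rewrite /=; lia |].
apply: (@runs_seq_var _ _ _ 0); [by split=> //=; lia | by rewrite /=; lia |].
apply: (runs_weaken (Q' := greedy_inv N)
          (T' := 150 * N + 100 * degree_sum adj + 100)) => //.
  apply: (runs_while (f := fun k => 100 + 50 * slot_degree (k + s0))).
  - move=> k st hk G; split; last exact: greedy_bodyP.
    case: (G) => -[[[hI hN hn] hO] hD] [k' _] _ _.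
    by exists 1 => //; split; rewrite /= k' hN hk //; split; lia.
  - move=> st [[[[hI hN hn] hO] hD] [k' _] _ _].
    by split; rewrite /= k' hN ltnn //; split; lia.
  - rewrite big_split /= sum_nat_const card_ord -big_distrr /=.
    by move: sum_slot_degree; set S := \sum_(i < N) _; nia.
  (* For [s0 <= 1] one has [uphalf s0 = s0], so the initial schedule is empty and [x0] is a
     dummy. *)
  - split=> //; first by move=> v; right.
    left; split=> //; exists (fun=> x0); split=> //=.
    + by move=> i; have := uphalf_half s0; lia.
    + by move=> i; lia.
    + by move=> y; case: (used0 y).
by rewrite /=; lia.
Qed.

End Greedy.

Lemma greedy_success_correct s0 st pk :
  s0 <= 1 -> s0 + #|Y| <= n.+1 -> n <= s0 + #|Y| ->
  greedy_success s0 N st pk -> correct_output e (put_arr st aOut 0 1).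
Proof.
move=> hs0 hE hE' [ED0 _ _ O0]; left; split=> //.
exists (mkseq (slot_path xs x0 pk s0) #|'I_N|); split.
  apply: slot_path_hamiltonian => // i hi; apply: ED0.
  by have := card_N; lia.
rewrite card_ord /mkseq -map_comp; apply/eq_in_map => k.
by rewrite mem_iota /= => hk; rewrite /upd /= O0.
Qed.

Lemma ham_prog_mainP st T : input st -> (forall i, arrs st aDl i = 0) ->
  (forall i, arrs st aUsed i = 0) ->
  500 * N + 220 * degree_sum adj + 600 <= T ->
  runs w (offsets_prog ;; sweep_prog ;;
      vs0 ::= Var vN < Var vn + Var vn + Const 1 ;;
      greedy_prog ;;
      If (Var vfail) (vs0 ::= Const 0 ;; greedy_prog) Skip) st T
    (fun st' => correct_output e (put_arr st' aOut 0 1)).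
Proof.
move=> I0 D0 U0 hT; have cN := card_N; have LB := encode_length_ge xs adj.
have Yle := card_Yside_le CB n0 M; have Yge := card_Yside_ge n0 M.
apply: (@runs_seq _ _ _ _ _ (40 * N + 40)); last by lia.
apply: (offsets_progP I0) => // st1 I1 O1 D1 U1.
apply: (@runs_seq _ _ _ _ _ (60 * N + 20 * degree_sum adj + 60)); last by lia.
apply: (@sweep_progP st1) => // [y|st2 I2 D2 U2]; first by rewrite D1 D0.
case: (I2) => -[hI hN hn] hO.
set s0 : nat := #|Y| <= n.
have hs0 : s0 <= 1 by exact: leq_b1.
have hE : s0 + #|Y| <= n.+1.
  by rewrite /s0; case: (leqP #|Y| n) => /= h; rewrite ?add1n ?add0n.
have hE' : n <= s0 + #|Y|.
  by move: Yge; rewrite /s0; case: (leqP #|Y| n) => /=; lia.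
apply: (@runs_seq_var _ _ _ s0).
- by split; rewrite /= hN hn /s0; [do !split; lia | lia].
- by rewrite /=; lia.
apply: (@runs_seq _ _ _ _ _ (200 * N + 100 * degree_sum adj + 200));
  last by rewrite /=; lia.
apply: (greedy_progP hs0 hE hE') => //=.
  by move=> v; rewrite U2 U1 U0.
move=> st3 [T3 [k3 s3] U3 R3]; rewrite /= in U3.
case: (T3) => -[[hI3 hN3 hn3] hO3] hD3.
apply: (@runs_if _ _ (vars st3 vfail)).
- by split=> //=; case: R3 => -[-> _]; lia.
- by rewrite /=; lia.
- case: R3 => [[-> //]|[f3 nH] _].
  (* Failure of Hall's condition excludes [|Y| = n + 1] and then [|Y| < n]; in the remaining case
     starting at slot 0 succeeds. *)
  have s1 : s0 = 1.
    rewrite /s0; case: (leqP #|Y| n) => // lt_nY; case: nH.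
    have -> : s0 = 0 by rewrite /s0 leqNgt lt_nY.
    rewrite add0n; apply: (hall_large CB n0 M).
    by apply/eqP; rewrite eqn_leq Yle.
  rewrite s1 in U3 nH hE hE'.
  have cY : #|Y| = n.
    case: (ltngtP #|Y| n) => // h; last by lia.
    by case: nH; apply: (hall_small CB n0 M).
  apply: (@runs_seq_var _ _ _ 0); [by split=> //=; lia | by rewrite /=; lia |].
  apply: (@greedy_progP 0) => //=; rewrite ?add0n ?cY //.
  (* The first run left only marks 0 and 2, while the second one writes 1. *)
  + by move=> v; case: (U3 v) => ->; rewrite // U2 U1 U0.
  + by lia.
  move=> st4 [_ _ _ [[_ [pk S4]]|[_ nH0]]].
    by apply: (greedy_success_correct _ _ _ S4); rewrite ?add0n ?cY.
  by case: nH0; apply: (hall_medium CB n0 M).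
- case: R3 => [[f3 [pk S3]] _|[-> //]].
  apply: runs_skip; first by rewrite /=; lia.
  exact: (greedy_success_correct hs0 hE hE' S3).
Qed.

End Phases.

Lemma degree_sumE N (e : rel 'I_N) adj : adjacency_lists e adj ->
  degree_sum adj = #|[set a : 'I_N * 'I_N | e a.1 a.2]|.
Proof.
move=> adjP; rewrite -sum1dep_card -(pair_big_dep xpredT e (fun _ _ => 1)) /=.
apply: eq_bigr => v _; have [uA memA] := adjP v.
by rewrite -(card_uniqP uA) -sum1_card; apply: eq_bigl.
Qed.

(** With X empty no edge can cross the bipartition, so connectedness leaves a single vertex. *)
Lemma no_X_single_vertex N (e : rel 'I_N) : convex_bipartite e [::] ->
  N = 1 /\ forall x : 'I_N, hamiltonian_path e [:: x].
Proof.
case=> _ [N0 con] _ bip _; rewrite card_ord in N0.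
have eqV (u v : 'I_N) : u = v.
  case/connectP: (con u v) => -[|z p] /=; first by [].
  by case/andP=> /bip.
split; last by move=> x; split=> // v; rewrite inE (eqV v x).
case: (ltngtP N 1) => // h; first by lia.
by have /(congr1 val) := eqV (Ordinal N0) (Ordinal h).
Qed.

(* Words have O(log (size of G)) bits: there are (gsize e + 2) ^ k of them. *)
Theorem theorem7 :
  exists (P : cmd) (c k : nat),
    forall (N : nat) (e : rel 'I_N) (xs : seq 'I_N) (adj : 'I_N -> seq 'I_N),
      convex_bipartite e xs ->
      monotone_graph e xs ->
      adjacency_lists e adj ->
      exists (t : nat) (st : state),
        [/\ exec ((gsize e + 2) ^ k) P (init_state (encode xs adj)) t st,
            t <= c * gsize e
          & correct_output e st].
Proof.
exists ham_prog, 2000, 4 => N e xs adj CB M adjP.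
have [N0 Uxs] : 0 < N /\ uniq xs by case: CB => _ [+ _]; rewrite card_ord.
pose x0 := Ordinal N0.
have nN := size_xs_le Uxs.
have gN : N <= gsize e by rewrite /gsize card_ord leq_addr.
have gD : degree_sum adj <= 2 * gsize e + 1.
  rewrite (degree_sumE adjP) /gsize /num_edges.
  by move: #|[set a : 'I_N * 'I_N | e a.1 a.2]| => m; lia.
set g := gsize e in gN gD *.
(* The encoding has length at most [4g + 3], so [16(g + 2)] words suffice, and [g >= 1]. *)
have w_ge : 4 * encode_length xs adj + 20 <= (g + 2) ^ 4.
  rewrite /encode_length (expnS _ 3) (expnS _ 2) -mulnn; nia.
set w := (g + 2) ^ 4 in w_ge *.
have LB := encode_length_ge xs adj.
suff [t [st [h1 h2 h3]]] :
    runs w ham_prog (init_state (encode xs adj)) (2000 * g) (correct_output e).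
  by exists t, st.
apply: (@runs_seq_var _ _ _ N); [by split=> //=; lia | by rewrite /=; lia |].
apply: (@runs_seq_var _ _ _ (size xs)); [by split=> //=; lia | by rewrite /=; lia |].
apply: (@runs_seq _ _ _ _ _ (1900 * g)); last by rewrite /=; lia.
apply: (runs_weaken (Q' := fun st => correct_output e (put_arr st aOut 0 1))
                    (T' := 1900 * g)) => // [|st C].
  apply: (@runs_if _ _ (size xs)).
  - by split; rewrite /= /upd //=; lia.
  - by rewrite /=; lia.
  - rewrite -lt0n => n0; apply: (ham_prog_mainP x0 w_ge Uxs adjP CB M n0) => //.
    by rewrite /=; lia.
  move/size0nil=> xs0; rewrite xs0 in CB.
  have [N1 ham] := no_X_single_vertex CB.
  apply: runs_skip; first by rewrite /=; lia.
  (* Output cell 1 still holds its initial 0, the name of [x0]. *)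
  left; split=> //; exists [:: x0]; split; first exact: ham.
  by rewrite [in iota _ _]N1.
by apply: (@runs_set_arr _ _ _ _ 0 1) => //=;
  [split=> //=; lia | split=> //=; lia | lia].
Qed.
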